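(* Let $0\le k\le\omega$ and let $C,D$ be two $(\omega,k)$-categories. If $f\colon C\to D$ is a discrete Conduché fibration and $D$ is freely generated by an $(\omega,k)$-polygraph $Q$, then $C$ is also freely generated by an $(\omega,k)$-polygraph $P$. The $n$-generators of $P$ can be chosen as those cells $a\in C_n$ such that $f_n(a)=q_n(b)$ for some $b\in Q_n$, where $q_n\colon Q_n\to D_n$ is the inclusion map of the $n$-generators in $D_n$.
   Context: A strict $\omega$-category $C$ is a globular set with sets $C_n$ of $n$-cells, $i$-source and $i$-target maps $\mathsf{s}_i,\mathsf{t}_i$, units $1^n$ and compositions $x\ast_i y$ of $n$-cells ($0\le i<n$), defined when $x,y$ are $i$-composable, i.e. $\mathsf{t}_i(x)=\mathsf{s}_i(y)$, satisfying the usual strict axioms; $1^m(y)$ also denotes the iterated unit in dimension $m$ of a cell $y$ of dimension $n<m$. An $n$-cell ($n>0$) is invertible if it has an inverse for $\ast_{n-1}$. For $0\le k\le\omega$, an $(\omega,k)$-category is a strict $\omega$-category all of whose $n$-cells with $n>k$ are invertible; $\mathbf{Cat}_{\omega,k}$ is the full subcategory of the category $\mathbf{Cat}_\omega$ of strict $\omega$-categories that they form, and $\pi^k\colon\mathbf{Cat}_\omega\to\mathbf{Cat}_{\omega,k}$ is the left adjoint of the inclusion. Discrete Conduché fibrations. A morphism $f\colon C\to D$ of $(\omega,k)$-categories is a discrete Conduché fibration if: (c1) for $0\le n<m$, $y\in D_n$ and $x\in C_m$ with $f(x)=1^m(y)$, there is a unique $z\in C_n$ with $x=1^m(z)$; (c2)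 for $0\le i<n$, if $y_1,y_2$ are $i$-composable cells of $D_n$ and $x\in C_n$ satisfies $f(x)=y_1\ast_i y_2$, there is a unique pair $(x_1,x_2)$ of $i$-composable cells of $C_n$ with $x=x_1\ast_i x_2$, $f(x_1)=y_1$, $f(x_2)=y_2$. Polygraphs. Let $\mathbb{D}_n$ be the strict $\omega$-category freely generated by the representable $n$-globe and $\mathsf{i}_n\colon\mathbb{S}_{n-1}\to\mathbb{D}_n$ the inclusion of the sub-$\omega$-category obtained by removing the unique non-identity $n$-cell. An $(\omega,k)$-polygraph $P$ with its freely generated $(\omega,k)$-category $P^\top$ is given inductively: a set $P_0$, with $X^{(0)}=P_0$ (a discrete $\omega$-category); for each $n\ge1$ a set $P_n$ of $n$-generators together with, for each $a\in P_n$, a pair of parallel $(n-1)$-cells (source and target of $a$) of $X^{(n-1)}$, with $X^{(n)}$ the pushout in $\mathbf{Cat}_{\omega,k}$ of $\coprod_{P_n}\pi^k(\mathbb{D}_n)\leftarrow\coprod_{P_n}\pi^k(\mathbb{S}_{n-1})\to X^{(n-1)}$; finally $P^\top=\mathrm{colim}_n X^{(n)}$. Each $n$-generator determines an $n$-cell of $P^\top$ (the inclusion of generators). An $(\omega,k)$-category $C$ is freely generated by $P$ if $C\cong P^\top$; the corresponding maps $P_n\to C_n$ are the inclusions of the generators. *)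

(* Defs.v *)
From mathcomp Require Import all_boot zify.
From mathcomp Require Import boolp.

Set Implicit Arguments.
Unset Strict Implicit.
Unset Printing Implicit Defensive.

(* All the iterated operations of a strict omega-category are primitive:
   [src h x] is the i-source of the n-cell x for [h : i < n], [ident h y] is the
   iterated unit 1^m(y) of the n-cell y for [h : n < m].  Composition is in
   diagrammatic order and takes a proof of composability.  The axioms quantify
   over all the composability proofs that they involve; these are derivable. *)
Record omega_cat := OmegaCat {
  cell : nat -> Type;
  src : forall n i, i < n -> cell n -> cell i;
  tgt : forall n i, i < n -> cell n -> cell i;
  ident : forall n m, n < m -> cell n -> cell m;
  comp : forall n i (h : i < n) (x y : cell n), tgt h x = src h y -> cell n;
  src_src : forall n j i (hj : j < n) (hi : i < j) (h : i < n) x,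
    src hi (src hj x) = src h x;
  src_tgt : forall n j i (hj : j < n) (hi : i < j) (h : i < n) x,
    src hi (tgt hj x) = src h x;
  tgt_src : forall n j i (hj : j < n) (hi : i < j) (h : i < n) x,
    tgt hi (src hj x) = tgt h x;
  tgt_tgt : forall n j i (hj : j < n) (hi : i < j) (h : i < n) x,
    tgt hi (tgt hj x) = tgt h x;
  src_ident : forall n m (h : n < m) y, src h (ident h y) = y;
  tgt_ident : forall n m (h : n < m) y, tgt h (ident h y) = y;
  ident_ident : forall n m p (h1 : n < m) (h2 : m < p) (h : n < p) y,
    ident h2 (ident h1 y) = ident h y;
  src_comp : forall n i (h : i < n) x y (e : tgt h x = src h y),
    src h (comp e) = src h x;
  tgt_comp : forall n i (h : i < n) x y (e : tgt h x = src h y),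
    tgt h (comp e) = tgt h y;
  src_comp_gt : forall n j i (hj : j < n) (hi : i < j) (h : i < n) x y
      (e : tgt h x = src h y) (e' : tgt hi (src hj x) = src hi (src hj y)),
    src hj (comp e) = comp e';
  tgt_comp_gt : forall n j i (hj : j < n) (hi : i < j) (h : i < n) x y
      (e : tgt h x = src h y) (e' : tgt hi (tgt hj x) = src hi (tgt hj y)),
    tgt hj (comp e) = comp e';
  comp_assoc : forall n i (h : i < n) x y z
      (exy : tgt h x = src h y) (eyz : tgt h y = src h z)
      (el : tgt h (comp exy) = src h z) (er : tgt h x = src h (comp eyz)),
    comp el = comp er;
  comp_identl : forall n i (h : i < n) x
      (e : tgt h (ident h (src h x)) = src h x),
    comp e = x;
  comp_identr : forall n i (h : i < n) x
      (e : tgt h x = src h (ident h (tgt h x))),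
    comp e = x;
  ident_comp : forall n m i (h : n < m) (hn : i < n) (hm : i < m) x y
      (e : tgt hn x = src hn y)
      (e' : tgt hm (ident h x) = src hm (ident h y)),
    ident h (comp e) = comp e';
  exchange : forall n j i (hj : j < n) (hi : i < n), i < j ->
    forall x y z w (exy : tgt hj x = src hj y) (ezw : tgt hj z = src hj w)
      (exz : tgt hi x = src hi z) (eyw : tgt hi y = src hi w)
      (el : tgt hi (comp exy) = src hi (comp ezw))
      (er : tgt hj (comp exz) = src hj (comp eyw)),
    comp el = comp er
}.
Arguments src {o n i} h x.
Arguments tgt {o n i} h x.
Arguments ident {o n m} h y.
Arguments comp {o n i} h {x y} e.

Definition parallel C n (x y : cell C n) : Prop :=
  forall i (h : i < n), src h x = src h y /\ tgt h x = tgt h y.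

Record functor (C D : omega_cat) := Functor {
  fmap :> forall n, cell C n -> cell D n;
  fmap_src : forall n i (h : i < n) x, fmap (src h x) = src h (fmap x);
  fmap_tgt : forall n i (h : i < n) x, fmap (tgt h x) = tgt h (fmap x);
  fmap_ident : forall n m (h : n < m) y, fmap (ident h y) = ident h (fmap y);
  fmap_comp : forall n i (h : i < n) x y (e : tgt h x = src h y)
      (e' : tgt h (fmap x) = src h (fmap y)),
    fmap (comp h e) = comp h e'
}.
Arguments fmap {C D} f n x : rename.

Definition feq C D (f g : functor C D) : Prop := forall n x, f n x = g n x.

Program Definition fid C : functor C C := @Functor C C (fun n x => x) _ _ _ _.
Next Obligation. by rewrite (Prop_irrelevance e e'). Qed.

Program Definition fcomp C D E (g : functor D E) (f : functor C D) :
  functor C E := @Functor C E (fun n x => g n (f n x)) _ _ _ _.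
Next Obligation. by rewrite !fmap_src. Qed.
Next Obligation. by rewrite !fmap_tgt. Qed.
Next Obligation. by rewrite !fmap_ident. Qed.
Next Obligation.
have e1 : tgt h (f n x) = src h (f n y) by rewrite -fmap_tgt -fmap_src e.
by rewrite (fmap_comp e e1) (fmap_comp e1 e').
Qed.

(* [None] stands for omega. *)
Definition above (k : option nat) (n : nat) : Prop :=
  if k is Some k' then k' < n else False.

Definition is_inverse C n (x y : cell C n.+1) : Prop :=
  exists (exy : tgt (ltnSn n) x = src (ltnSn n) y)
         (eyx : tgt (ltnSn n) y = src (ltnSn n) x),
    comp (ltnSn n) exy = ident (ltnSn n) (src (ltnSn n) x) /\
    comp (ltnSn n) eyx = ident (ltnSn n) (tgt (ltnSn n) x).

Definition invertible C n (x : cell C n.+1) : Prop := exists y, is_inverse x y.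

Definition is_omega_k (k : option nat) (C : omega_cat) : Prop :=
  forall n, above k n.+1 -> forall x : cell C n.+1, invertible x.

Definition conduche_ident C D (f : functor C D) : Prop :=
  forall n m (h : n < m) (y : cell D n) (x : cell C m),
    f m x = ident h y -> exists! z : cell C n, x = ident h z.

Definition conduche_comp C D (f : functor C D) : Prop :=
  forall n i (h : i < n) (y1 y2 : cell D n) (e : tgt h y1 = src h y2)
    (x : cell C n),
    f n x = comp h e ->
    exists! p : cell C n * cell C n,
      exists e' : tgt h p.1 = src h p.2,
        [/\ x = comp h e', f n p.1 = y1 & f n p.2 = y2].

Definition discrete_conduche C D (f : functor C D) : Prop :=
  conduche_ident f /\ conduche_comp f.

Section GlobularShapes.

(* Omega-categories in which every composition involves a unit.  Such a category
   is given by its non-identity cells: (j, false) and (j, true) are the source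
   and the target j-cells of the cells of dimension > j, and an m-cell is a pair
   (j, b) with j <= m, read as 1^m(j, b). *)
Variable ok : nat -> bool -> bool.
Hypothesis ok_closed : forall j b i b', ok j b -> i < j -> ok i b'.

Definition gcell (m : nat) : Type :=
  {p : nat * bool | ok p.1 p.2 && (p.1 <= m)}.

Lemma gcell_inj m (x y : gcell m) : val x = val y -> x = y.
Proof. exact: val_inj. Qed.

Definition gcut (b : bool) (i : nat) (p : nat * bool) : nat * bool :=
  if p.1 <= i then p else (i, b).

Lemma gcut_ok b n i (h : i < n) (p : gcell n) :
  ok (gcut b i (val p)).1 (gcut b i (val p)).2 && ((gcut b i (val p)).1 <= i).
Proof.
case: p => [[j c] /= /andP[hp hj]]; rewrite /gcut /=.
case: leqP => [-> | hij] /=; first by rewrite hp.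
by rewrite leqnn (ok_closed b hp hij).
Qed.

Definition gface b n i (h : i < n) (p : gcell n) : gcell i :=
  exist _ (gcut b i (val p)) (gcut_ok b h p).

Lemma gident_ok n m (h : n < m) (p : gcell n) :
  ok (val p).1 (val p).2 && ((val p).1 <= m).
Proof.
by case: p => [[j c] /= /andP[-> hj]]; rewrite (leq_trans hj (ltnW h)).
Qed.

Definition gident n m (h : n < m) (p : gcell n) : gcell m :=
  exist _ (val p) (gident_ok h p).

(* If x and y are i-composable, then one of them is an identity on an i-cell. *)
Definition gcomp n i (h : i < n) (x y : gcell n)
  (_ : gface true h x = gface false h y) : gcell n :=
  if (val x).1 <= i then y else x.

Lemma val_gcomp n i (h : i < n) x y (e : gface true h x = gface false h y) :
  val (gcomp e) = if (val x).1 <= i then val y else val x.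
Proof. by rewrite /gcomp; case: ifP. Qed.

Ltac shape_tac :=
  apply: gcell_inj;
  repeat match goal with
  | e : gface _ _ _ = gface _ _ _ |- _ =>
      move: (congr1 val e); rewrite /= ?val_gcomp /=; clear e
  end;
  rewrite /= ?val_gcomp /=;
  repeat match goal with
  | p : gcell _ |- _ =>
      move: (andP (valP p)) => /= [_]; move: (sval p); clear p; case=> ? ? /=
  end;
  rewrite /gcut /=;
  repeat match goal with
  | |- context [if ?b then _ else _] =>
      lazymatch b with
      | context [if _ then _ else _] => fail
      | _ => destruct b eqn:?; rewrite /=
      end
  end; intros;
  repeat match goal with
  | H : (_, _) = (_, _) |- _ => injection H; clear H; intros
  end; subst; simpl in *; try discriminate;
  try (f_equal; lia); try (exfalso; lia).

Definition globular_shape : omega_cat.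
Proof.
refine (@OmegaCat gcell (gface false) (gface true) gident gcomp
    _ _ _ _ _ _ _ _ _ _ _ _ _ _ _ _).
all: abstract (repeat (let a := fresh "a" in intro a); shape_tac).
Defined.

End GlobularShapes.

(* (n, false) is the top cell of [globe n]; there is no cell (n, true). *)
Definition globe_ok (n j : nat) (b : bool) : bool :=
  (j < n) || ((j == n) && ~~ b).

Lemma globe_ok_closed n j b i b' : globe_ok n j b -> i < j -> globe_ok n i b'.
Proof. by rewrite /globe_ok => /orP[h|/andP[/eqP<- _]] hi; apply/orP; lia. Qed.

Definition globe (n : nat) : omega_cat := globular_shape (@globe_ok_closed n).

Lemma globe_top_subproof n : globe_ok n n false && (n <= n).
Proof. by rewrite /globe_ok eqxx leqnn orbT. Qed.

Definition globe_top (n : nat) : cell (globe n) n :=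
  exist _ (n, false) (globe_top_subproof n).

Definition sphere_ok (n j : nat) (b : bool) : bool := j <= n.

Lemma sphere_ok_closed n j b i b' : sphere_ok n j b -> i < j -> sphere_ok n i b'.
Proof. by rewrite /sphere_ok; lia. Qed.

(* The n-sphere is [globe n.+1] without its non-identity (n+1)-cell (and the
   units on it). *)
Definition sphere (n : nat) : omega_cat := globular_shape (@sphere_ok_closed n).

Lemma sphere_cell_subproof n b : sphere_ok n n b && (n <= n).
Proof. by rewrite /sphere_ok leqnn. Qed.

Definition sphere_src (n : nat) : cell (sphere n) n :=
  exist _ (n, false) (sphere_cell_subproof n false).
Definition sphere_tgt (n : nat) : cell (sphere n) n :=
  exist _ (n, true) (sphere_cell_subproof n true).

Lemma sphere_incl_subproof n m (x : cell (sphere n) m) :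
  globe_ok n.+1 (sval x).1 (sval x).2 && ((sval x).1 <= m).
Proof.
case: x => [[j b] /= /andP[h ->]]; rewrite andbT /globe_ok.
by move: h; rewrite /sphere_ok ltnS => ->.
Qed.

Definition sphere_incl (n : nat) : functor (sphere n) (globe n.+1).
Proof.
refine (@Functor (sphere n) (globe n.+1)
  (fun m x => exist _ (sval x) (sphere_incl_subproof x)) _ _ _ _).
- by move=> m i h x; apply: gcell_inj.
- by move=> m i h x; apply: gcell_inj.
- by move=> m i h x; apply: gcell_inj.
- by move=> m i h x y e e'; apply: gcell_inj; rewrite /= !val_gcomp.
Defined.

Definition discrete (A : Type) : omega_cat.
Proof.
by refine (@OmegaCat (fun _ => A) (fun _ _ _ x => x) (fun _ _ _ x => x)
  (fun _ _ _ x => x) (fun _ _ _ x _ _ => x) _ _ _ _ _ _ _ _ _ _ _ _ _ _ _ _).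
Defined.

Section Casts.
Variable C : omega_cat.

Lemma le_eq_or_lt n m : n <= m -> {n = m} + {n < m}.
Proof. by rewrite leq_eqVlt; case: eqVneq => [e _|_ /= h]; [left | right]. Qed.

Definition idle n m (h : n <= m) (y : cell C n) : cell C m :=
  match le_eq_or_lt h with
  | left e => eq_rect n (cell C) y m e
  | right h' => ident h' y
  end.

Lemma idle_lt n m (h : n <= m) (h' : n < m) y : idle h y = ident h' y.
Proof.
rewrite /idle; case: le_eq_or_lt => [e|h0]; first by exfalso; lia.
by rewrite (Prop_irrelevance h0 h').
Qed.

Lemma idle_refl n (h : n <= n) y : idle h y = y.
Proof.
rewrite /idle; case: le_eq_or_lt => [e|h0]; last by exfalso; lia.
by rewrite (Prop_irrelevance e erefl).
Qed.

Definition face (b : bool) n i (h : i <= n) (y : cell C n) : cell C i :=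
  match le_eq_or_lt h with
  | left e => eq_rect n (cell C) y i (esym e)
  | right h' => if b then tgt h' y else src h' y
  end.

Lemma face_lt b n i (h : i <= n) (h' : i < n) y :
  face b h y = if b then tgt h' y else src h' y.
Proof.
rewrite /face; case: le_eq_or_lt => [e|h0]; first by exfalso; lia.
by rewrite (Prop_irrelevance h0 h').
Qed.

Lemma face_refl b n (h : n <= n) y : face b h y = y.
Proof.
rewrite /face; case: le_eq_or_lt => [e|h0]; last by exfalso; lia.
by rewrite (Prop_irrelevance (esym e) erefl).
Qed.

Lemma src_face b n i j (h : i <= n) (hj : j < i) (hn : j < n) y :
  src hj (face b h y) = src hn y.
Proof.
case: (le_eq_or_lt h) => [e|h'].
  by subst i; rewrite face_refl (Prop_irrelevance hj hn).
rewrite (face_lt b h h'); case: b;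
  [exact: src_tgt | exact: src_src].
Qed.

Lemma tgt_face b n i j (h : i <= n) (hj : j < i) (hn : j < n) y :
  tgt hj (face b h y) = tgt hn y.
Proof.
case: (le_eq_or_lt h) => [e|h'].
  by subst i; rewrite face_refl (Prop_irrelevance hj hn).
rewrite (face_lt b h h'); case: b;
  [exact: tgt_tgt | exact: tgt_src].
Qed.

Lemma src_idle_ge n m i (h : n <= m) (him : i < m) (hn : n <= i) y :
  src him (idle h y) = idle hn y.
Proof.
have hnm : n < m by lia.
rewrite (idle_lt h hnm); case: (le_eq_or_lt hn) => [e|h'].
  by subst i; rewrite idle_refl (Prop_irrelevance him hnm) src_ident.
by rewrite (idle_lt hn h') -(ident_ident h' him) src_ident.
Qed.

Lemma tgt_idle_ge n m i (h : n <= m) (him : i < m) (hn : n <= i) y :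
  tgt him (idle h y) = idle hn y.
Proof.
have hnm : n < m by lia.
rewrite (idle_lt h hnm); case: (le_eq_or_lt hn) => [e|h'].
  by subst i; rewrite idle_refl (Prop_irrelevance him hnm) tgt_ident.
by rewrite (idle_lt hn h') -(ident_ident h' him) tgt_ident.
Qed.

Lemma src_idle_lt n m i (h : n <= m) (him : i < m) (hn : i < n) y :
  src him (idle h y) = src hn y.
Proof.
case: (le_eq_or_lt h) => [e|h'].
  by subst m; rewrite idle_refl (Prop_irrelevance him hn).
by rewrite (idle_lt h h') -(src_src h' hn him) src_ident.
Qed.

Lemma tgt_idle_lt n m i (h : n <= m) (him : i < m) (hn : i < n) y :
  tgt him (idle h y) = tgt hn y.
Proof.
case: (le_eq_or_lt h) => [e|h'].
  by subst m; rewrite idle_refl (Prop_irrelevance him hn).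
by rewrite (idle_lt h h') -(tgt_src h' hn him) src_ident.
Qed.

Lemma ident_idle n m p (h : n <= m) (h' : m < p) (h'' : n <= p) y :
  ident h' (idle h y) = idle h'' y.
Proof.
have hnp : n < p by lia.
rewrite (idle_lt h'' hnp); case: (le_eq_or_lt h) => [e|h1].
  by subst m; rewrite idle_refl (Prop_irrelevance h' hnp).
by rewrite (idle_lt h h1); exact: ident_ident.
Qed.

End Casts.

Lemma fmap_idle C D (f : functor C D) n m (h : n <= m) y :
  f m (idle h y) = idle h (f n y).
Proof.
case: (le_eq_or_lt h) => [e|h']; first by subst m; rewrite !idle_refl.
by rewrite !(idle_lt h h') fmap_ident.
Qed.

Section ShapeFunctors.
Variables (ok : nat -> bool -> bool).
Hypothesis ok_closed : forall j b i b', ok j b -> i < j -> ok i b'.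
Variables (E : omega_cat) (z : forall j b, ok j b -> cell E j).
Hypothesis z_src : forall j b (h : ok j b) i (hi : i < j) (h' : ok i false),
  src hi (z h) = z h'.
Hypothesis z_tgt : forall j b (h : ok j b) i (hi : i < j) (h' : ok i true),
  tgt hi (z h) = z h'.

Lemma gcell_okP n (p : gcell ok n) : ok (sval p).1 (sval p).2.
Proof. by case/andP: (svalP p). Qed.

Lemma gcell_leP n (p : gcell ok n) : (sval p).1 <= n.
Proof. by case/andP: (svalP p). Qed.

Definition shape_fmap n (p : gcell ok n) : cell E n :=
  idle (gcell_leP p) (z (gcell_okP p)).

Lemma shape_fmapE n (p : gcell ok n) j b (h : ok j b) (h' : j <= n) :
  sval p = (j, b) -> shape_fmap p = idle h' (z h).
Proof.
case: p => [[j' b'] hp] /= [ej eb]; subst j' b'; rewrite /shape_fmap /=.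
set p := exist _ _ _.
rewrite (Prop_irrelevance (gcell_okP p : ok j b) h).
by rewrite (Prop_irrelevance (gcell_leP p : j <= n) h').
Qed.

Lemma shape_fmap_src n i (h : i < n) (p : gcell ok n) :
  shape_fmap (gface ok_closed false h p) = src h (shape_fmap p).
Proof.
case: p => [[j b] hp]; have /= /andP[ho hj] := hp.
rewrite (shape_fmapE (p := exist _ (j, b) hp) ho hj) //.
case: (leqP j i) => hji.
  have e : sval (gface ok_closed false h (exist _ (j, b) hp)) = (j, b).
    by rewrite /= /gcut /= hji.
  by rewrite (shape_fmapE ho hji e) (src_idle_ge _ _ hji).
have hi := ok_closed false ho hji.
have e : sval (gface ok_closed false h (exist _ (j, b) hp)) = (i, false).
  by rewrite /= /gcut /= leqNgt hji.
by rewrite (shape_fmapE hi (leqnn i) e) idle_refl (src_idle_lt _ _ hji) (z_src _ _ hi).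
Qed.

Lemma shape_fmap_tgt n i (h : i < n) (p : gcell ok n) :
  shape_fmap (gface ok_closed true h p) = tgt h (shape_fmap p).
Proof.
case: p => [[j b] hp]; have /= /andP[ho hj] := hp.
rewrite (shape_fmapE (p := exist _ (j, b) hp) ho hj) //.
case: (leqP j i) => hji.
  have e : sval (gface ok_closed true h (exist _ (j, b) hp)) = (j, b).
    by rewrite /= /gcut /= hji.
  by rewrite (shape_fmapE ho hji e) (tgt_idle_ge _ _ hji).
have hi := ok_closed true ho hji.
have e : sval (gface ok_closed true h (exist _ (j, b) hp)) = (i, true).
  by rewrite /= /gcut /= leqNgt hji.
by rewrite (shape_fmapE hi (leqnn i) e) idle_refl (tgt_idle_lt _ _ hji) (z_tgt _ _ hi).
Qed.

Definition shape_functor : functor (globular_shape ok_closed) E.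
Proof.
refine (@Functor (globular_shape ok_closed) E shape_fmap _ _ _ _).
- exact: shape_fmap_src.
- exact: shape_fmap_tgt.
- move=> n m h [[j b] hp]; have /= /andP[ho hj] := hp.
  rewrite (shape_fmapE (p := exist _ (j, b) hp) ho hj) //.
  have hjm : j <= m by lia.
  by rewrite (shape_fmapE ho hjm) // (ident_idle _ _ hjm).
move=> n i h x y e e'; case: (boolP ((sval x).1 <= i)) => hx.
  have -> : comp (o := globular_shape ok_closed) h e = y.
    by apply: gcell_inj; rewrite /= val_gcomp /= hx.
  have hxE : shape_fmap x = ident h (src h (shape_fmap y)).
    rewrite -e' {1}/shape_fmap [in RHS]/shape_fmap (tgt_idle_ge _ _ hx).
    by rewrite (ident_idle _ _ (gcell_leP x)).
  by move: e'; rewrite hxE => e'; rewrite comp_identl.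
have hy : (sval y).1 <= i.
  move: (congr1 sval e); rewrite /= /gcut (negbTE hx).
  by case: ifP => // _ [].
have -> : comp (o := globular_shape ok_closed) h e = x.
  by apply: gcell_inj; rewrite /= val_gcomp /= (negbTE hx).
have hyE : shape_fmap y = ident h (tgt h (shape_fmap x)).
  rewrite e' {1}/shape_fmap [in RHS]/shape_fmap (src_idle_ge _ _ hy).
  by rewrite (ident_idle _ _ (gcell_leP y)).
by move: e'; rewrite hyE => e'; rewrite comp_identr.
Defined.

Lemma shape_functor_unique (F : functor (globular_shape ok_closed) E) :
  (forall j b (h : ok j b) (h' : ok j b && (j <= j)),
    F j (exist _ (j, b) h') = z h) ->
  feq F shape_functor.
Proof.
move=> HF m [[j b] hp]; have /= /andP[ho hj] := hp.
rewrite (shape_fmapE (p := exist _ (j, b) hp) ho hj) //.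
have h' : ok j b && (j <= j) by rewrite ho leqnn.
rewrite -(HF j b ho h') -fmap_idle; congr (F m _).
case: (le_eq_or_lt hj) => [e|hjm].
  by subst m; rewrite idle_refl; exact: gcell_inj.
by rewrite (idle_lt hj hjm); exact: gcell_inj.
Qed.

End ShapeFunctors.

(* [globe n] is freely generated by the representable n-globe: by Yoneda,
   functors from [globe n] to E amount to n-cells of E. *)
Lemma globe_free n E (e : cell E n) :
  exists F : functor (globe n) E, F n (globe_top n) = e /\
    forall F' : functor (globe n) E, F' n (globe_top n) = e -> feq F' F.
Proof.
have le j b : globe_ok n j b -> j <= n by rewrite /globe_ok; lia.
pose z j b (h : globe_ok n j b) := face b (le j b h) e.
have lt j b i (h : globe_ok n j b) (hi : i < j) : i < n by have := le j b h; lia.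
have zs j b h i (hi : i < j) h' : src hi (z j b h) = z i false h'.
  by rewrite /z (src_face _ _ _ (lt _ _ _ h hi)) (face_lt _ _ (lt _ _ _ h hi)).
have zt j b h i (hi : i < j) h' : tgt hi (z j b h) = z i true h'.
  by rewrite /z (tgt_face _ _ _ (lt _ _ _ h hi)) (face_lt _ _ (lt _ _ _ h hi)).
exists (shape_functor (@globe_ok_closed n) zs zt); split.
  have h : globe_ok n n false by rewrite /globe_ok eqxx orbT.
  by rewrite /= (shape_fmapE _ h (leqnn n)) // idle_refl /z face_refl.
move=> F HF; apply: shape_functor_unique => j b h h'; rewrite /z.
case: (le_eq_or_lt (le j b h)) => [e0|hj].
  subst j; have b0 : b = false by move: h; rewrite /globe_ok ltnn eqxx; case: b {h'}.
  subst b; rewrite face_refl -HF; congr (F n _); exact: gcell_inj.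
rewrite (face_lt _ _ hj) -HF.
have top : (n <= j) = false by lia.
case: b h h' => h h'; rewrite -?fmap_src -?fmap_tgt; congr (F j _);
  by apply: gcell_inj; rewrite /= /gcut /= top.
Qed.

Lemma sphere_free n E (x y : cell E n) : parallel x y ->
  exists F : functor (sphere n) E,
    [/\ F n (sphere_src n) = x, F n (sphere_tgt n) = y &
      forall F' : functor (sphere n) E,
        F' n (sphere_src n) = x -> F' n (sphere_tgt n) = y -> feq F' F].
Proof.
move=> pxy; pose w (b : bool) := if b then y else x.
pose z j b (h : sphere_ok n j b) := face b (h : j <= n) (w b).
have lt j b i (h : sphere_ok n j b) (hi : i < j) : i < n.
  exact: leq_trans hi h.
have zs j b h i (hi : i < j) h' : src hi (z j b h) = z i false h'.
  have hin := lt _ _ _ h hi; rewrite /z (src_face _ _ _ hin) (face_lt _ _ hin).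
  by case: b {h} => //=; rewrite (pxy i hin).1.
have zt j b h i (hi : i < j) h' : tgt hi (z j b h) = z i true h'.
  have hin := lt _ _ _ h hi; rewrite /z (tgt_face _ _ _ hin) (face_lt _ _ hin).
  by case: b {h} => //=; rewrite (pxy i hin).2.
exists (shape_functor (@sphere_ok_closed n) zs zt); split.
- have h : sphere_ok n n false by rewrite /sphere_ok.
  by rewrite /= (shape_fmapE _ h (leqnn n)) // idle_refl /z face_refl.
- have h : sphere_ok n n true by rewrite /sphere_ok.
  by rewrite /= (shape_fmapE _ h (leqnn n)) // idle_refl /z face_refl.
move=> F Fx Fy; apply: shape_functor_unique => j b h h'; rewrite /z.
case: (le_eq_or_lt (h : j <= n)) => [e0|hj].
  subst j; rewrite face_refl.
  by case: b h h' => h h'; rewrite /w -?Fx -?Fy; congr (F n _); exact: gcell_inj.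
rewrite (face_lt _ _ hj).
have top : (n <= j) = false by lia.
by case: b h h' => h h'; rewrite /w -?Fx -?Fy -?fmap_src -?fmap_tgt;
  congr (F j _); apply: gcell_inj; rewrite /= /gcut /= top.
Qed.

Lemma inverse_unique C n (x y z : cell C n.+1) :
  is_inverse x y -> is_inverse x z -> y = z.
Proof.
move=> [exy [eyx [hxy hyx]]] [exz [ezx [hxz hzx]]].
have el : tgt (ltnSn n) (comp _ eyx) = src (ltnSn n) z by rewrite tgt_comp.
have er : tgt (ltnSn n) y = src (ltnSn n) (comp _ exz) by rewrite src_comp.
have := comp_assoc el er.
move: el er; rewrite hyx hxz => el er.
have -> : comp (ltnSn n) er = y.
  by move: er; rewrite -eyx => er; rewrite comp_identr.
have -> : comp (ltnSn n) el = z.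
  by move: el; rewrite exz => el; rewrite comp_identl.
by [].
Qed.

Lemma fmap_inverse C D (f : functor C D) n (x y : cell C n.+1) :
  is_inverse x y -> is_inverse (f _ x) (f _ y).
Proof.
move=> [exy [eyx [hxy hyx]]].
have e1 : tgt (ltnSn n) (f _ x) = src (ltnSn n) (f _ y).
  by rewrite -fmap_src -fmap_tgt exy.
have e2 : tgt (ltnSn n) (f _ y) = src (ltnSn n) (f _ x).
  by rewrite -fmap_src -fmap_tgt eyx.
exists e1, e2; rewrite -(fmap_comp exy) -(fmap_comp eyx) hxy hyx.
by rewrite !fmap_ident fmap_src fmap_tgt.
Qed.

Section Universal.

(* The (omega,k)-category generated by the family G, modulo all the relations
   that hold in every (omega,k)-category E under every interpretation of G in E
   satisfying Phi.  It is the set of classes of formal expressions which are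
   defined under all these interpretations. *)
Variables (k : option nat) (G : nat -> Type).
Variable Phi : forall E : omega_cat, (forall n, G n -> cell E n) -> Prop.

Inductive term : nat -> Type :=
| Tgen n of G n : term n
| Tsrc n i of i < n & term n : term i
| Ttgt n i of i < n & term n : term i
| Tident n m of n < m & term n : term m
| Tcomp n i of i < n & term n & term n : term n
| Tinv n of term n.+1 : term n.+1.

Fixpoint ev E (phi : forall n, G n -> cell E n) n (t : term n) :
    cell E n -> Prop :=
  match t in term n return cell E n -> Prop with
  | Tgen n g => fun x => x = phi n g
  | Tsrc n i h t => fun x => exists2 y, ev phi t y & x = src h y
  | Ttgt n i h t => fun x => exists2 y, ev phi t y & x = tgt h y
  | Tident n m h t => fun x => exists2 y, ev phi t y & x = ident h y
  | Tcomp n i h t u => fun x => exists y z, exists e : tgt h y = src h z,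
      [/\ ev phi t y, ev phi u z & x = comp h e]
  | Tinv n t => fun x => exists2 y, ev phi t y & is_inverse y x
  end.

Lemma ev_unique E (phi : forall n, G n -> cell E n) n (t : term n) x y :
  ev phi t x -> ev phi t y -> x = y.
Proof.
elim: t x y => {n} /= [n g|n i h t IH|n i h t IH|n m h t IH|n i h t IHt u IHu
  |n t IH] x y.
- by move=> -> ->.
- by move=> [a ha ->] [b hb ->]; rewrite (IH _ _ ha hb).
- by move=> [a ha ->] [b hb ->]; rewrite (IH _ _ ha hb).
- by move=> [a ha ->] [b hb ->]; rewrite (IH _ _ ha hb).
- move=> [a [b [e [ha hb ->]]]] [a' [b' [e' [ha' hb' ->]]]].
  have ea := IHt _ _ ha ha'; have eb := IHu _ _ hb hb'; subst a' b'.
  by rewrite (Prop_irrelevance e e').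
- move=> [a ha hx] [b hb]; rewrite -(IH _ _ ha hb); exact: inverse_unique.
Qed.

Definition model E (phi : forall n, G n -> cell E n) : Prop :=
  is_omega_k k E /\ Phi phi.

Definition valid n (t : term n) : Prop :=
  forall E (phi : forall n, G n -> cell E n), model phi -> exists x, ev phi t x.

Definition class n (t : term n) : term n -> Prop := fun u =>
  forall E (phi : forall n, G n -> cell E n), model phi ->
    forall x, ev phi t x <-> ev phi u x.

Definition ucell (n : nat) : Type :=
  {S : term n -> Prop | exists2 t, valid t & S = class t}.

Definition mk n (t : term n) (v : valid t) : ucell n :=
  exist _ (class t) (ex_intro2 _ _ t v erefl).

Definition rep n (u : ucell n) : term n := projT1 (cid2 (svalP u)).

Lemma rep_valid n (u : ucell n) : valid (rep u).
Proof. by rewrite /rep; case: (cid2 _). Qed.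

Lemma rep_class n (u : ucell n) : sval u = class (rep u).
Proof. by rewrite /rep; case: (cid2 _). Qed.

Section Value.
Variables (E : omega_cat) (phi : forall n, G n -> cell E n) (M : model phi).

Definition value n (u : ucell n) : cell E n := projT1 (cid (rep_valid u M)).

Lemma value_rep n (u : ucell n) : ev phi (rep u) (value u).
Proof. by rewrite /value; case: (cid _). Qed.

Lemma value_mk n (t : term n) (v : valid t) : ev phi t (value (mk v)).
Proof.
have h : class t (rep (mk v)).
  by rewrite -[class t]/(sval (mk v)) rep_class => ? ? ? ?.
by apply/(h _ _ M); exact: value_rep.
Qed.

Lemma value_mkE n (t : term n) (v : valid t) x : ev phi t x -> value (mk v) = x.
Proof. exact/ev_unique/value_mk. Qed.

End Value.

Lemma ucell_eq n (u v : ucell n) :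
  (forall E (phi : forall n, G n -> cell E n) (M : model phi),
    value M u = value M v) -> u = v.
Proof.
move=> h; suff e : sval u = sval v.
  by case: u v e {h} => [S hS] [T hT] /= e; subst T;
    rewrite (Prop_irrelevance hS hT).
rewrite !rep_class; apply/funext => t; apply/propext.
have H w : class (rep w) t <-> forall E (phi : forall n, G n -> cell E n)
    (M : model phi) x, x = value M w <-> ev phi t x.
  split=> hw E phi M x; first rewrite -(hw E phi M); last rewrite -(hw E phi M).
    split=> [->|hx]; first exact: value_rep.
    by apply: ev_unique hx (value_rep M w).
  split=> [hx|->]; last exact: value_rep.
  by apply: ev_unique hx (value_rep M w).
by split=> /H hh; apply/H => E phi M x;
  [rewrite -(h _ _ M) | rewrite (h _ _ M)]; exact: hh.
Qed.

Lemma usrc_subproof n i (h : i < n) (u : ucell n) : valid (Tsrc h (rep u)).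
Proof.
move=> E phi M; exists (src h (value M u)); exists (value M u) => //.
exact: value_rep.
Qed.
Definition usrc n i (h : i < n) (u : ucell n) : ucell i := mk (usrc_subproof h u).

Lemma utgt_subproof n i (h : i < n) (u : ucell n) : valid (Ttgt h (rep u)).
Proof.
move=> E phi M; exists (tgt h (value M u)); exists (value M u) => //.
exact: value_rep.
Qed.
Definition utgt n i (h : i < n) (u : ucell n) : ucell i := mk (utgt_subproof h u).

Lemma uident_subproof n m (h : n < m) (u : ucell n) : valid (Tident h (rep u)).
Proof.
move=> E phi M; exists (ident h (value M u)); exists (value M u) => //.
exact: value_rep.
Qed.
Definition uident n m (h : n < m) (u : ucell n) : ucell m :=
  mk (uident_subproof h u).

Lemma value_usrc E (phi : forall n, G n -> cell E n) (M : model phi)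
  n i (h : i < n) u : value M (usrc h u) = src h (value M u).
Proof. by apply: value_mkE; exists (value M u) => //; exact: value_rep. Qed.

Lemma value_utgt E (phi : forall n, G n -> cell E n) (M : model phi)
  n i (h : i < n) u : value M (utgt h u) = tgt h (value M u).
Proof. by apply: value_mkE; exists (value M u) => //; exact: value_rep. Qed.

Lemma value_uident E (phi : forall n, G n -> cell E n) (M : model phi)
  n m (h : n < m) u : value M (uident h u) = ident h (value M u).
Proof. by apply: value_mkE; exists (value M u) => //; exact: value_rep. Qed.

Lemma value_composable E (phi : forall n, G n -> cell E n) (M : model phi)
  n i (h : i < n) (u v : ucell n) :
  utgt h u = usrc h v -> tgt h (value M u) = src h (value M v).
Proof. by move=> e; rewrite -value_utgt -value_usrc e. Qed.

Lemma ucomp_subproof n i (h : i < n) (u v : ucell n) (e : utgt h u = usrc h v) :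
  valid (Tcomp h (rep u) (rep v)).
Proof.
move=> E phi M; exists (comp h (value_composable M e)).
exists (value M u), (value M v), (value_composable M e).
by split=> //; exact: value_rep.
Qed.

Definition ucomp n i (h : i < n) (u v : ucell n) (e : utgt h u = usrc h v) :
  ucell n := mk (ucomp_subproof e).

Lemma value_ucomp E (phi : forall n, G n -> cell E n) (M : model phi)
  n i (h : i < n) u v (e : utgt h u = usrc h v)
  (e' : tgt h (value M u) = src h (value M v)) :
  value M (ucomp e) = comp h e'.
Proof.
apply: value_mkE; exists (value M u), (value M v), e'.
by split=> //; exact: value_rep.
Qed.

Definition universal : omega_cat.
Proof.
refine (@OmegaCat ucell usrc utgt uident ucomp
  _ _ _ _ _ _ _ _ _ _ _ _ _ _ _ _).
- by move=> n j i hj hi h x; apply: ucell_eq => E phi M;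
    rewrite !value_usrc (src_src _ _ h).
- by move=> n j i hj hi h x; apply: ucell_eq => E phi M;
    rewrite !value_usrc value_utgt (src_tgt _ _ h).
- by move=> n j i hj hi h x; apply: ucell_eq => E phi M;
    rewrite !value_utgt value_usrc (tgt_src _ _ h).
- by move=> n j i hj hi h x; apply: ucell_eq => E phi M;
    rewrite !value_utgt (tgt_tgt _ _ h).
- by move=> n m h y; apply: ucell_eq => E phi M;
    rewrite value_usrc value_uident src_ident.
- by move=> n m h y; apply: ucell_eq => E phi M;
    rewrite value_utgt value_uident tgt_ident.
- by move=> n m p h1 h2 h y; apply: ucell_eq => E phi M;
    rewrite !value_uident (ident_ident _ _ h).
- move=> n i h x y e; apply: ucell_eq => E phi M.
  by rewrite !value_usrc (value_ucomp e (value_composable M e)) src_comp.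
- move=> n i h x y e; apply: ucell_eq => E phi M.
  by rewrite !value_utgt (value_ucomp e (value_composable M e)) tgt_comp.
- move=> n j i hj hi h x y e e'; apply: ucell_eq => E phi M.
  have a := value_composable M e; have b := value_composable M e'.
  rewrite value_usrc (value_ucomp e a) (value_ucomp e' b).
  by move: b; rewrite !value_usrc => b; exact: src_comp_gt.
- move=> n j i hj hi h x y e e'; apply: ucell_eq => E phi M.
  have a := value_composable M e; have b := value_composable M e'.
  rewrite value_utgt (value_ucomp e a) (value_ucomp e' b).
  by move: b; rewrite !value_utgt => b; exact: tgt_comp_gt.
- move=> n i h x y z exy eyz el er; apply: ucell_eq => E phi M.
  have a := value_composable M exy; have b := value_composable M eyz.
  rewrite (value_ucomp el (value_composable M el)).
  rewrite (value_ucomp er (value_composable M er)).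
  move: (value_composable M el) (value_composable M er).
  rewrite (value_ucomp exy a) (value_ucomp eyz b) => c d.
  exact: comp_assoc.
- move=> n i h x e; apply: ucell_eq => E phi M.
  rewrite (value_ucomp e (value_composable M e)).
  move: (value_composable M e); rewrite value_uident value_usrc => c.
  exact: comp_identl.
- move=> n i h x e; apply: ucell_eq => E phi M.
  rewrite (value_ucomp e (value_composable M e)).
  move: (value_composable M e); rewrite value_uident value_utgt => c.
  exact: comp_identr.
- move=> n m i h hn hm x y e e'; apply: ucell_eq => E phi M.
  rewrite value_uident (value_ucomp e (value_composable M e)).
  rewrite (value_ucomp e' (value_composable M e')).
  move: (value_composable M e) (value_composable M e').
  rewrite !value_uident => c d; exact: ident_comp.
- move=> n j i hj hi hij x y z w exy ezw exz eyw el er.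
  apply: ucell_eq => E phi M.
  have a := value_composable M exy; have b := value_composable M ezw.
  have c := value_composable M exz; have d := value_composable M eyw.
  rewrite (value_ucomp el (value_composable M el)).
  rewrite (value_ucomp er (value_composable M er)).
  move: (value_composable M el) (value_composable M er).
  rewrite (value_ucomp exy a) (value_ucomp ezw b).
  rewrite (value_ucomp exz c) (value_ucomp eyw d) => el' er'.
  exact: exchange.
Defined.

Lemma ucell_inverse n (u v : ucell n.+1) :
  (forall E (phi : forall n, G n -> cell E n) (M : model phi),
    is_inverse (value M u) (value M v)) -> @is_inverse universal n u v.
Proof.
move=> H.
have e1 : utgt (ltnSn n) u = usrc (ltnSn n) v.
  by apply: ucell_eq => E phi M; rewrite value_utgt value_usrc; case: (H E phi M).
have e2 : utgt (ltnSn n) v = usrc (ltnSn n) u.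
  by apply: ucell_eq => E phi M; rewrite value_utgt value_usrc;
    case: (H E phi M) => ? [].
exists e1, e2; split; apply: ucell_eq => E phi M;
  case: (H E phi M) => a [b [ha hb]] /=.
- by rewrite (value_ucomp e1 a) ha value_uident value_usrc.
- by rewrite (value_ucomp e2 b) hb value_uident value_utgt.
Qed.

Lemma universal_omega_k : is_omega_k k universal.
Proof.
move=> n hn u.
have v : valid (Tinv (rep u)).
  move=> E phi M; case: (M) => hE _; case: (hE n hn (value M u)) => y hy.
  by exists y, (value M u) => //; exact: value_rep.
exists (mk v); apply: ucell_inverse => E phi M.
case: (value_mk M v) => y hy; rewrite (ev_unique hy (value_rep M u)).
by [].
Qed.

Lemma universal_gen_subproof n (g : G n) : valid (Tgen g).
Proof. by move=> E phi M; exists (phi n g). Qed.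

Definition universal_gen n (g : G n) : cell universal n :=
  mk (universal_gen_subproof g).

Lemma value_gen E (phi : forall n, G n -> cell E n) (M : model phi) n g :
  value M (universal_gen g) = phi n g.
Proof. exact: value_mkE. Qed.

Definition universal_lift E (phi : forall n, G n -> cell E n) (M : model phi) :
  functor universal E.
Proof.
refine (@Functor universal E (@value E phi M) _ _ _ _).
- by move=> n i h x; exact: value_usrc.
- by move=> n i h x; exact: value_utgt.
- by move=> n m h x; exact: value_uident.
- by move=> n i h x y e e'; exact: value_ucomp.
Defined.

Lemma universal_lift_gen E (phi : forall n, G n -> cell E n) (M : model phi) n g :
  universal_lift M n (universal_gen g) = phi n g.
Proof. exact: value_gen. Qed.

Lemma universal_lift_unique E (phi : forall n, G n -> cell E n) (M : model phi)
    (F : functor universal E) :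
  (forall n g, F n (universal_gen g) = phi n g) -> feq F (universal_lift M).
Proof.
move=> HF.
have H n (t : term n) : forall u : ucell n,
    (forall E' (psi : forall n, G n -> cell E' n) (M' : model psi),
       ev psi t (value M' u)) -> ev phi t (F n u).
  elim: t => {n} /= [n g|n i h t IH|n i h t IH|n m h t IH|n i h t IHt s IHs
    |n t IH] u Hu.
  - have -> : u = universal_gen g; last exact: HF.
    by apply: ucell_eq => E' psi M'; rewrite (Hu _ _ M') value_gen.
  - have v : valid t by move=> E' psi M'; case: (Hu _ _ M') => y; exists y.
    exists (F n (mk v)); first by apply: IH => *; exact: value_mk.
    rewrite -fmap_src; congr (F i _); apply: ucell_eq => E' psi M'.
    rewrite value_usrc; case: (Hu _ _ M') => y hy ->.
    by rewrite (value_mkE _ _ hy).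
  - have v : valid t by move=> E' psi M'; case: (Hu _ _ M') => y; exists y.
    exists (F n (mk v)); first by apply: IH => *; exact: value_mk.
    rewrite -fmap_tgt; congr (F i _); apply: ucell_eq => E' psi M'.
    rewrite value_utgt; case: (Hu _ _ M') => y hy ->.
    by rewrite (value_mkE _ _ hy).
  - have v : valid t by move=> E' psi M'; case: (Hu _ _ M') => y; exists y.
    exists (F n (mk v)); first by apply: IH => *; exact: value_mk.
    rewrite -fmap_ident; congr (F m _); apply: ucell_eq => E' psi M'.
    rewrite value_uident; case: (Hu _ _ M') => y hy ->.
    by rewrite (value_mkE _ _ hy).
  - have v : valid t.
      by move=> E' psi M'; case: (Hu _ _ M') => y [z [e []]]; exists y.
    have w : valid s.
      by move=> E' psi M'; case: (Hu _ _ M') => y [z [e []]]; exists z.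
    have e : utgt h (mk v) = usrc h (mk w).
      apply: ucell_eq => E' psi M'; rewrite value_utgt value_usrc.
      case: (Hu _ _ M') => y [z [e [hy hz _]]].
      by rewrite (value_mkE _ _ hy) (value_mkE _ _ hz).
    have e' : tgt h (F n (mk v)) = src h (F n (mk w)).
      by rewrite -fmap_tgt -fmap_src; congr (F i _).
    exists (F n (mk v)), (F n (mk w)), e'; split.
    + by apply: IHt => *; exact: value_mk.
    + by apply: IHs => *; exact: value_mk.
    rewrite -(@fmap_comp _ _ F _ _ h _ _ e e'); congr (F n _).
    apply: ucell_eq => E' psi M'; rewrite (value_ucomp e (value_composable M' e)).
    move: (value_composable M' e).
    case: (Hu _ _ M') => y [z [e0 [hy hz ->]]].
    rewrite (value_mkE _ _ hy) (value_mkE _ _ hz) => e1.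
    by rewrite (Prop_irrelevance e0 e1).
  - have v : valid t by move=> E' psi M'; case: (Hu _ _ M') => y; exists y.
    exists (F _ (mk v)); first by apply: IH => *; exact: value_mk.
    apply: fmap_inverse; apply: ucell_inverse => E' psi M'.
    by case: (Hu _ _ M') => y hy; rewrite (value_mkE _ _ hy).
move=> n u; apply: (@ev_unique _ phi _ (rep u)); last exact: value_rep.
by apply: H => *; exact: value_rep.
Qed.

End Universal.

Section FreeFunctors.
Variables (k : option nat) (I : Type) (A : I -> omega_cat).

Definition functor_family (E : omega_cat)
    (phi : forall n, {i : I & cell (A i) n} -> cell E n) : Prop :=
  forall i, exists F : functor (A i) E, forall n x, F n x = phi n (existT _ i x).

(* If the A i are (omega,k)-categories, this is their coproduct in the category
   of (omega,k)-categories; in general, the coproduct of their reflections. *)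
Definition coprod : omega_cat := universal k functor_family.

Definition coprod_in (i : I) : functor (A i) coprod.
Proof.
refine (@Functor (A i) coprod
  (fun n x => universal_gen k functor_family (existT _ i x)) _ _ _ _).
- move=> n j h x; apply: ucell_eq => E phi M;
    have [F HF] := proj2 M i.
  by rewrite value_usrc !value_gen -!HF fmap_src.
- move=> n j h x; apply: ucell_eq => E phi M;
    have [F HF] := proj2 M i.
  by rewrite value_utgt !value_gen -!HF fmap_tgt.
- move=> n m h x; apply: ucell_eq => E phi M;
    have [F HF] := proj2 M i.
  by rewrite value_uident !value_gen -!HF fmap_ident.
- move=> n j h x y e e'; apply: ucell_eq => E phi M.
  rewrite (value_ucomp e' (value_composable M e')).
  move: (value_composable M e'); rewrite !value_gen.
  by have [F HF] := proj2 M i; rewrite -!HF => c; exact: fmap_comp.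
Defined.

Lemma coprod_omega_k : is_omega_k k coprod.
Proof. exact: universal_omega_k. Qed.

Section Copair.
Variables (E : omega_cat) (hE : is_omega_k k E) (g : forall i, functor (A i) E).

Lemma copair_subproof : model k functor_family
  (fun n (x : {i : I & cell (A i) n}) => g (projT1 x) n (projT2 x)).
Proof. by split=> // i; exists (g i). Qed.

Definition copair : functor coprod E := universal_lift copair_subproof.

Lemma copair_in i : feq (fcomp copair (coprod_in i)) (g i).
Proof. by move=> n x; rewrite /= value_gen. Qed.

Lemma copair_unique (h : functor coprod E) :
  (forall i, feq (fcomp h (coprod_in i)) (g i)) -> feq h copair.
Proof. by move=> H; apply: universal_lift_unique => n [i x]; exact: H. Qed.

End Copair.

End FreeFunctors.
Arguments coprod_omega_k : clear implicits.

Section Reflection.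
Variables (k : option nat) (C : omega_cat).

(* The value at C of the left adjoint pi^k of the inclusion of
   (omega,k)-categories into omega-categories, with its unit. *)
Definition pik : omega_cat := coprod k (fun _ : unit => C).

Definition pik_unit : functor C pik := coprod_in k (fun _ : unit => C) tt.

Lemma pik_omega_k : is_omega_k k pik.
Proof. exact: coprod_omega_k. Qed.

Definition pik_lift E (hE : is_omega_k k E) (g : functor C E) : functor pik E :=
  copair hE (fun _ : unit => g).

Lemma pik_lift_unit E (hE : is_omega_k k E) (g : functor C E) :
  feq (fcomp (pik_lift hE g) pik_unit) g.
Proof. exact: (@copair_in k unit (fun _ => C) E hE (fun _ => g) tt). Qed.

Lemma pik_lift_unique E (hE : is_omega_k k E) (g : functor C E)
    (h : functor pik E) :
  feq (fcomp h pik_unit) g -> feq h (pik_lift hE g).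
Proof.
move=> H; apply: (@copair_unique k unit (fun _ => C) E hE (fun _ => g) h) => -[].
exact: H.
Qed.

End Reflection.
Arguments pik_omega_k : clear implicits.

Definition pik_map k C D (f : functor C D) : functor (pik k C) (pik k D) :=
  pik_lift (pik_omega_k k D) (fcomp (pik_unit k D) f).

Definition coprod_map k I (A B : I -> omega_cat)
    (f : forall i, functor (A i) (B i)) : functor (coprod k A) (coprod k B) :=
  copair (coprod_omega_k k I B) (fun i => fcomp (coprod_in k B i) (f i)).

Definition is_pushout (k : option nat) A B X Y (u : functor A B)
    (f : functor A X) (v : functor X Y) (g : functor B Y) : Prop :=
  [/\ is_omega_k k Y, feq (fcomp g u) (fcomp v f) &
    forall E, is_omega_k k E ->
      forall (g' : functor B E) (v' : functor X E),
        feq (fcomp g' u) (fcomp v' f) ->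
      exists h : functor Y E,
        [/\ feq (fcomp h g) g', feq (fcomp h v) v' &
          forall h' : functor Y E,
            feq (fcomp h' g) g' -> feq (fcomp h' v) v' -> feq h' h]].

Definition is_seq_colimit (k : option nat) (X : nat -> omega_cat)
    (v : forall n, functor (X n) (X n.+1)) (T : omega_cat)
    (j : forall n, functor (X n) T) : Prop :=
  [/\ is_omega_k k T, forall n, feq (fcomp (j n.+1) (v n)) (j n) &
    forall E, is_omega_k k E ->
      forall g : forall n, functor (X n) E,
        (forall n, feq (fcomp (g n.+1) (v n)) (g n)) ->
      exists h : functor T E,
        (forall n, feq (fcomp h (j n)) (g n)) /\
        forall h' : functor T E,
          (forall n, feq (fcomp h' (j n)) (g n)) -> feq h' h].

(* The coproducts of copies of pi^k(S_n) and pi^k(D_(n+1)). *)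
Definition spheres k n (I : Type) : omega_cat :=
  coprod k (fun _ : I => pik k (sphere n)).
Definition globes k n (I : Type) : omega_cat :=
  coprod k (fun _ : I => pik k (globe n)).

Definition spheres_incl k n (I : Type) :
    functor (spheres k n I) (globes k n.+1 I) :=
  coprod_map k (fun _ : I => pik_map k (sphere_incl n)).

Definition spheres_cell k n I (a : I) m (x : cell (sphere n) m) :
    cell (spheres k n I) m :=
  coprod_in k (fun _ : I => pik k (sphere n)) a m (pik_unit k (sphere n) m x).

Definition globes_cell k n I (a : I) m (x : cell (globe n) m) :
    cell (globes k n I) m :=
  coprod_in k (fun _ : I => pik k (globe n)) a m (pik_unit k (globe n) m x).

(* X^(0) is the discrete category on the 0-generators, and X^(n+1) is
   [stage n]. *)
Definition skeleton (G0 : Type) (stage : nat -> omega_cat) (n : nat) :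
    omega_cat :=
  if n is n'.+1 then stage n' else discrete G0.

(* Pushouts and colimits are given by their universal properties, so that a
   polygraph carries a choice of the X^(n) and of P^top. *)
Record polygraph (k : option nat) := Polygraph {
  gen : nat -> Type;
  stage : nat -> omega_cat;
  skel := skeleton (gen 0) stage;
  gen_src : forall n, gen n.+1 -> cell (skel n) n;
  gen_tgt : forall n, gen n.+1 -> cell (skel n) n;
  gen_parallel : forall n (a : gen n.+1), parallel (gen_src a) (gen_tgt a);
  attach : forall n, functor (spheres k n (gen n.+1)) (skel n);
  attach_src : forall n (a : gen n.+1),
    attach n n (spheres_cell k a (sphere_src n)) = gen_src a;
  attach_tgt : forall n (a : gen n.+1),
    attach n n (spheres_cell k a (sphere_tgt n)) = gen_tgt a;
  skel_incl : forall n, functor (skel n) (skel n.+1);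
  charact : forall n, functor (globes k n.+1 (gen n.+1)) (skel n.+1);
  skel_pushout : forall n,
    is_pushout k (spheres_incl k n (gen n.+1)) (attach n)
      (skel_incl n) (charact n);
  free_cat : omega_cat;
  free_cat_in : forall n, functor (skel n) free_cat;
  free_cat_colimit : is_seq_colimit k skel_incl free_cat_in
}.

Definition gen_cell k (P : polygraph k) (n : nat) :
    gen P n -> cell (free_cat P) n :=
  match n return gen P n -> cell (free_cat P) n with
  | 0 => fun a => free_cat_in P 0 0 a
  | n'.+1 => fun a =>
      free_cat_in P n'.+1 n'.+1
        (charact P n' n'.+1 (globes_cell k a (globe_top n'.+1)))
  end.

Record iso (C D : omega_cat) := Iso {
  iso_fun :> functor C D;
  iso_inv : functor D C;
  iso_invK : feq (fcomp iso_fun iso_inv) (fid D);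
  iso_funK : feq (fcomp iso_inv iso_fun) (fid C)
}.

Definition freely_generated k (C : omega_cat) (P : polygraph k) : Type :=
  iso (free_cat P) C.

Definition gen_incl k (C : omega_cat) (P : polygraph k)
    (phi : freely_generated C P) n (a : gen P n) : cell C n :=
  iso_fun phi n (gen_cell a).

(* Main.v *)
From mathcomp Require Import all_boot zify.
From mathcomp Require Import boolp.
Require Import Defs.

(* A discrete Conduche fibration f : C -> D is exponentiable: for every E there
   is an omega-category over D whose m-cells over y are the functors to E from
   the pullback along f of the globe y : D_m -> D.  Functors X -> dprod E over D
   are thus functors X x_D C -> E, so that pulling back along f turns the
   pushouts and the colimit that build D from Q into pushouts and a colimit that
   build C; pulling back a generator b of Q gives one generator for each cell of
   C over b, because distinct generators of Q are distinct cells of D. *)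

Set Implicit Arguments.
Unset Strict Implicit.
Unset Printing Implicit Defensive.

(** A map on the fibres of [f] is kept as a relation between cells of [C] and cells of [E], not as a
    function on a dependent type of cells over a face. Faces, units and composites of such families
    then need no transport along equations in [D], and two families with the same base are equal as
    soon as one relation is contained in the other. The two Conduche conditions make these families
    an omega-category: a cell over a unit is a unit by (c1), and a cell over a composite factors in
    exactly one way by (c2), so a family extends to units and composites by acting on the pieces.
    Pushouts and colimits are tested against (omega,k)-categories only, so this omega-category must
    also be given inverses. Distinctness of generators is not formal, since [gen_cell] lands in a
    category known by a universal property alone. It is detected by functors to K(Z/2, n) with all
    n-cells linked by unique (n+1)-cells: there the class of each n-generator can be prescribed at
    will, and no obstruction arises in higher dimensions. *)

Section OmegaCatFacts.
Variable C : omega_cat.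

(** * Faces of units and of composites; one-sided inverses *)

Lemma src_irr n i (h h' : i < n) (x : cell C n) : src h x = src h' x.
Proof. by rewrite (Prop_irrelevance h h'). Qed.

Lemma tgt_irr n i (h h' : i < n) (x : cell C n) : tgt h x = tgt h' x.
Proof. by rewrite (Prop_irrelevance h h'). Qed.

Lemma ident_irr n m (h h' : n < m) (x : cell C n) : ident h x = ident h' x.
Proof. by rewrite (Prop_irrelevance h h'). Qed.

(** [comp] takes the composability proof as an argument, so equal cells cannot be rewritten under it
    directly; proof irrelevance settles this once for all. *)
Lemma comp_congr n i (h h' : i < n) (x x' y y' : cell C n)
    (e : tgt h x = src h y) (e' : tgt h' x' = src h' y') :
  x = x' -> y = y' -> comp h e = comp h' e'.
Proof.
move=> ex ey; subst x' y'; have eh : h = h' by exact: Prop_irrelevance.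
subst h'; by rewrite (Prop_irrelevance e e').
Qed.

Lemma comp_identl_eq n i (h : i < n) (z : cell C i) (x : cell C n)
    (e : tgt h (ident h z) = src h x) : comp h e = x.
Proof.
have ez : z = src h x by rewrite -e tgt_ident.
by subst z; exact: comp_identl.
Qed.

Lemma comp_identr_eq n i (h : i < n) (z : cell C i) (x : cell C n)
    (e : tgt h x = src h (ident h z)) : comp h e = x.
Proof.
have ez : z = tgt h x by rewrite e src_ident.
by subst z; exact: comp_identr.
Qed.

Lemma src_comp_lt n i i' (h : i < n) (h' : i' < n) (hi : i' < i)
    (x y : cell C n) (e : tgt h x = src h y) : src h' (comp h e) = src h' x.
Proof. by rewrite -(src_src h hi h') src_comp (src_src h hi h'). Qed.

Lemma tgt_comp_lt n i i' (h : i < n) (h' : i' < n) (hi : i' < i)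
    (x y : cell C n) (e : tgt h x = src h y) : tgt h' (comp h e) = tgt h' x.
Proof. by rewrite -(tgt_src h hi h') src_comp (tgt_src h hi h'). Qed.

Lemma src_ident_lt n m i (h : n < m) (hm : i < m) (hn : i < n) (x : cell C n) :
  src hm (ident h x) = src hn x.
Proof. by rewrite -(src_src h hn hm) src_ident. Qed.

Lemma tgt_ident_lt n m i (h : n < m) (hm : i < m) (hn : i < n) (x : cell C n) :
  tgt hm (ident h x) = tgt hn x.
Proof. by rewrite -(tgt_tgt h hn hm) tgt_ident. Qed.

Lemma src_ident_gt n m i (h : n < m) (hm : i < m) (hn : n < i) (x : cell C n) :
  src hm (ident h x) = ident hn x.
Proof. by rewrite -(ident_ident hn hm h) src_ident. Qed.

Lemma tgt_ident_gt n m i (h : n < m) (hm : i < m) (hn : n < i) (x : cell C n) :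
  tgt hm (ident h x) = ident hn x.
Proof. by rewrite -(ident_ident hn hm h) tgt_ident. Qed.

Lemma composable_src_lt n i i' (h : i < n) (h' : i' < n) (hi : i' < i)
    (x y : cell C n) (e : tgt h x = src h y) : src h' x = src h' y.
Proof. by rewrite -(src_tgt h hi h') e src_src. Qed.

Lemma composable_tgt_lt n i i' (h : i < n) (h' : i' < n) (hi : i' < i)
    (x y : cell C n) (e : tgt h x = src h y) : tgt h' x = tgt h' y.
Proof. by rewrite -(tgt_tgt h hi h') e tgt_src. Qed.

Lemma face_irr b n i (h h' : i <= n) (x : cell C n) : face b h x = face b h' x.
Proof. by rewrite (Prop_irrelevance h h'). Qed.

(** At [i = j] the outer [face] is the identity, so the sign is that of the inner source; below [j],
    globularity lets the outer sign win. *)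
Lemma face_src b n i j (hj : j < n) (hi : i <= j) (h : i <= n)
    (x : cell C n) :
  face b hi (src hj x) = face (if i == j then false else b) h x.
Proof.
case: (le_eq_or_lt hi) => [e|hlt].
  by subst i; rewrite eqxx face_refl (face_lt _ _ hj).
have hin : i < n by lia.
rewrite (face_lt _ _ hlt) (face_lt _ _ hin) (_ : (i == j) = false); last lia.
by case: b; [exact: tgt_src | exact: src_src].
Qed.

Lemma face_tgt b n i j (hj : j < n) (hi : i <= j) (h : i <= n)
    (x : cell C n) :
  face b hi (tgt hj x) = face (if i == j then true else b) h x.
Proof.
case: (le_eq_or_lt hi) => [e|hlt].
  by subst i; rewrite eqxx face_refl (face_lt _ _ hj).
have hin : i < n by lia.
rewrite (face_lt _ _ hlt) (face_lt _ _ hin) (_ : (i == j) = false); last lia.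
by case: b; [exact: tgt_tgt | exact: src_tgt].
Qed.

Lemma face_ident_le b n m j (h : n < m) (hj : j <= m) (hn : j <= n)
    (x : cell C n) : face b hj (ident h x) = face b hn x.
Proof.
have hm : j < m by lia.
rewrite (face_lt _ _ hm); case: (le_eq_or_lt hn) => [e|hlt].
  subst j; rewrite face_refl (tgt_irr hm h) (src_irr hm h).
  by rewrite tgt_ident src_ident if_same.
rewrite (face_lt _ _ hlt) -(tgt_src h hlt hm) -(src_src h hlt hm).
by rewrite src_ident.
Qed.

Lemma face_ident_gt b n m j (h : n < m) (hj : j <= m) (hn : n < j)
    (x : cell C n) : face b hj (ident h x) = ident hn x.
Proof.
case: (le_eq_or_lt hj) => [e|hlt].
  by subst j; rewrite face_refl (ident_irr h hn).
rewrite (face_lt _ _ hlt) -(ident_ident hn hlt h).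
by rewrite tgt_ident src_ident if_same.
Qed.

Lemma face_comp_lt b n i j (h : i < n) (hj : j <= n) (hi : j < i)
    (x y : cell C n) (e : tgt h x = src h y) :
  face b hj (comp h e) = face b hj x.
Proof.
have hn : j < n by lia.
by rewrite !(face_lt _ _ hn) (src_comp_lt _ hi) (tgt_comp_lt _ hi).
Qed.

Lemma face_comp_eq b n i (h : i < n) (hj : i <= n)
    (x y : cell C n) (e : tgt h x = src h y) :
  face b hj (comp h e) = face b hj (if b then y else x).
Proof. by rewrite !(face_lt _ _ h) src_comp tgt_comp; case: b. Qed.

Lemma face_composable b n i j (h : i < n) (hj : j <= n) (hi : i < j)
    (x y : cell C n) (e : tgt h x = src h y) :
  tgt hi (face b hj x) = src hi (face b hj y).
Proof. by rewrite (tgt_face _ _ _ h) (src_face _ _ _ h). Qed.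

Lemma face_comp_gt b n i j (h : i < n) (hj : j <= n) (hi : i < j)
    (x y : cell C n) (e : tgt h x = src h y)
    (e' : tgt hi (face b hj x) = src hi (face b hj y)) :
  face b hj (comp h e) = comp hi e'.
Proof.
case: (le_eq_or_lt hj) => [ej|hn].
  by subst j; rewrite face_refl; apply: comp_congr; rewrite face_refl.
move: e'; rewrite !(face_lt _ _ hn); case: b => e'.
  exact: tgt_comp_gt.
exact: src_comp_gt.
Qed.

(* [is_inverse] for an arbitrary proof of [n < m]; only used for [m = n.+1]. *)
Definition inverse_at n m (h : n < m) (x y : cell C m) : Prop :=
  exists (exy : tgt h x = src h y) (eyx : tgt h y = src h x),
    comp h exy = ident h (src h x) /\ comp h eyx = ident h (tgt h x).

Lemma is_inverse_sym n (x y : cell C n.+1) : is_inverse x y -> is_inverse y x.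
Proof.
move=> [exy [eyx [hxy hyx]]]; exists eyx, exy.
by rewrite hxy hyx exy eyx.
Qed.

(** Bracketing [y * x * z] in both ways gives [z] on one side and [y] on the other; [z] is only
    assumed to be a right inverse. *)
Lemma right_inverse_unique n (x y z : cell C n.+1)
    (e : tgt (ltnSn n) x = src (ltnSn n) z) :
  is_inverse x y -> comp (ltnSn n) e = ident (ltnSn n) (src (ltnSn n) x) ->
  z = y.
Proof.
move=> [exy [eyx [hxy hyx]]] hz.
have el : tgt (ltnSn n) (comp _ eyx) = src (ltnSn n) z by rewrite tgt_comp.
have er : tgt (ltnSn n) y = src (ltnSn n) (comp _ e) by rewrite src_comp.
have := comp_assoc el er.
move: el er; rewrite hyx hz => el er.
by rewrite comp_identl_eq comp_identr_eq.
Qed.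

(** As for groups: if [y] is a right inverse of [x] and [z] one of [y], then [x = x * y * z = z].
    Inverses can thus be verified on one side only. *)
Lemma right_inverses_invertible n :
  (forall x : cell C n.+1, exists y (e : tgt (ltnSn n) x = src (ltnSn n) y),
    comp (ltnSn n) e = ident (ltnSn n) (src (ltnSn n) x)) ->
  forall x : cell C n.+1, invertible x.
Proof.
move=> H x; have [y [exy hxy]] := H x; have [z [eyz hyz]] := H y.
have ez : x = z.
  have el : tgt (ltnSn n) (comp _ exy) = src (ltnSn n) z by rewrite tgt_comp.
  have er : tgt (ltnSn n) x = src (ltnSn n) (comp _ eyz) by rewrite src_comp.
  have := comp_assoc el er.
  move: el er; rewrite hxy hyz => el er.
  by rewrite comp_identl_eq comp_identr_eq.
subst z; exists y, exy, eyz; split=> //; by rewrite hyz exy.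
Qed.

End OmegaCatFacts.

Lemma fmap_face C D (f : functor C D) b n i (h : i <= n) x :
  f i (face b h x) = face b h (f n x).
Proof.
case: (le_eq_or_lt h) => [e|hlt]; first by subst i; rewrite !face_refl.
by rewrite !(face_lt _ _ hlt); case: b; rewrite ?fmap_src ?fmap_tgt.
Qed.

Lemma fmap_composable C D (f : functor C D) n i (h : i < n) x y :
  tgt h x = src h y -> tgt h (f n x) = src h (f n y).
Proof. by move=> e; rewrite -fmap_tgt -fmap_src e. Qed.

(** * Lifting units and composites through a discrete Conduche fibration *)

Section Conduche.
Variables (C D : omega_cat) (f : functor C D) (hf : discrete_conduche f).

Lemma conduche_lift_ident n m (h : n < m) (y : cell D n) (x : cell C m) :
  f m x = ident h y -> exists2 z, x = ident h z & f n z = y.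
Proof.
move=> hx; have [z [ez _]] := hf.1 _ _ h y x hx.
exists z => //; rewrite -(src_ident h y) -hx ez fmap_ident src_ident //.
Qed.

Lemma conduche_lift_comp n i (h : i < n) (y1 y2 : cell D n)
    (e : tgt h y1 = src h y2) (x : cell C n) : f n x = comp h e ->
  exists x1 x2 (e' : tgt h x1 = src h x2),
    [/\ x = comp h e', f n x1 = y1 & f n x2 = y2].
Proof.
by move=> hx; have [[x1 x2] [[e' H] _]] := hf.2 _ _ h _ _ e x hx; exists x1, x2, e'.
Qed.

(** Both pairs factor the same cell over the same factorization in [D], so the uniqueness half of
    (c2) identifies them. This makes [wcomp_rel] single-valued. *)
Lemma conduche_comp_inj n i (h : i < n) (x1 x2 x1' x2' : cell C n)
    (e : tgt h x1 = src h x2) (e' : tgt h x1' = src h x2') :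
  comp h e = comp h e' -> f n x1 = f n x1' -> f n x2 = f n x2' ->
  x1 = x1' /\ x2 = x2'.
Proof.
move=> hc h1 h2; have ef := fmap_composable f e.
have [p [_ U]] := hf.2 _ _ h _ _ ef _ (fmap_comp e ef).
have a : p = (x1, x2) by apply: U; exists e.
have b : p = (x1', x2') by apply: U; exists e'; rewrite -hc h1 h2.
by move: b; rewrite a => -[].
Qed.

End Conduche.

(** * Cells of the dependent product and their operations *)

Section DependentProduct.
Variables (C D E : omega_cat) (f : functor C D).

(* [wrel j b] is the graph of a map from the fibre of f over the j-face
   [face b _ wbase] to the j-cells of E; these maps form a functor to E from the
   pullback along f of the globe over D given by [wbase]. *)
Record wcell (m : nat) := WCell {
  wbase : cell D m;
  wrel : forall j, bool -> cell C j -> cell E j -> Prop;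
  wrel_base : forall j b x e, wrel (j := j) b x e ->
    exists h : j <= m, f j x = face b h wbase;
  wrel_total : forall j b (h : j <= m) x, f j x = face b h wbase ->
    exists e, wrel (j := j) b x e;
  wrel_fun : forall j b x e e', wrel (j := j) b x e -> wrel (j := j) b x e' ->
    e = e';
  wrel_top : forall x e, wrel (j := m) true x e -> wrel (j := m) false x e;
  wrel_src : forall j i (h : i < j) b x e, wrel (j := j) b x e ->
    wrel (j := i) false (src h x) (src h e);
  wrel_tgt : forall j i (h : i < j) b x e, wrel (j := j) b x e ->
    wrel (j := i) true (tgt h x) (tgt h e)
}.

(** In dimension [m] both signs denote the same fibre. The field [wrel_top] gives one inclusion; the
    other follows because the smaller relation is total and the larger one single-valued. *)
Lemma wrel_topE m (w : wcell m) b b' (x : cell C m) e : wrel w b x e -> wrel w b' x e.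
Proof.
case: b b' => [] [] //; first exact: wrel_top.
move=> hx; have [h hb] := wrel_base hx.
have [e' he'] : exists e', wrel w true x e'.
  by apply: (@wrel_total _ w m true h); rewrite hb !face_refl.
by rewrite (wrel_fun hx (wrel_top he')).
Qed.

(** A total relation contained in a single-valued one with the same domain equals it. Each axiom of
    the dependent product thus reduces to a single inclusion, in dimensions at most [m], since
    [wrel_base] makes the relations empty above. *)
Lemma wcell_eq m (w v : wcell m) : wbase w = wbase v ->
  (forall j b (x : cell C j) e, j <= m -> wrel w b x e -> wrel v b x e) -> w = v.
Proof.
move=> eb sub.
have er : wrel w = wrel v.
  apply: functional_extensionality_dep => j; apply/funext => b.
  apply/funext => x; apply/funext => e; apply/propext; split=> H.
    by have [h _] := wrel_base H; exact: sub.
  have [h hx] := wrel_base H; rewrite -eb in hx.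
  have [e' He'] := wrel_total hx.
  by rewrite (wrel_fun H (sub _ _ _ _ h He')).
case: w v eb er {sub} => [w r H1 H2 H3 H4 H5 H6] [v s K1 K2 K3 K4 K5 K6] /=.
move=> eb er; subst v s.
by f_equal; exact: Prop_irrelevance.
Qed.

Section Face.
Variables (c : bool) (n i : nat) (h : i < n) (w : wcell n).

(** In dimension [i] the fibre is the one over the face of sign [c], whatever [b] is; in lower
    dimensions a face of a face is a face of [w] with the sign [b] unchanged. *)
Definition wface_rel j (b : bool) (x : cell C j) (e : cell E j) : Prop :=
  j <= i /\ wrel w (if j == i then c else b) x e.

Definition wface_base : cell D i :=
  if c then tgt h (wbase w) else src h (wbase w).

Lemma face_wface_base j b (hj : j <= i) (hn : j <= n) :
  face b hj wface_base = face (if j == i then c else b) hn (wbase w).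
Proof.
by rewrite /wface_base; case: c; rewrite ?(face_src _ _ _ hn) ?(face_tgt _ _ _ hn).
Qed.

Definition wface : wcell i.
Proof.
refine (@WCell i wface_base wface_rel _ _ _ _ _ _).
- move=> j b x e [hj H]; exists hj; have [hn ->] := wrel_base H.
  by rewrite (face_wface_base _ _ hn).
- move=> j b hj x hx; have hn : j <= n by lia.
  rewrite (face_wface_base _ _ hn) in hx.
  by have [e He] := wrel_total hx; exists e.
- by move=> j b x e e' [_ H] [_ H']; exact: (wrel_fun H H').
- by move=> x e [hi]; rewrite eqxx => H; split; rewrite ?eqxx.
- move=> j l hl b x e [hj H]; split; first lia.
  by rewrite (_ : (l == i) = false); [exact: wrel_src H | lia].
- move=> j l hl b x e [hj H]; split; first lia.
  by rewrite (_ : (l == i) = false); [exact: wrel_tgt H | lia].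
Defined.

End Face.

Section Ident.
Variables (n m : nat) (h : n < m) (w : wcell n).

(** Above dimension [n] the cells over a unit are units, and a unit must go to the unit on the
    image. The sign [false] is a choice between equivalent ones, by [wrel_topE]. *)
Definition wident_rel j (b : bool) (x : cell C j) (e : cell E j) : Prop :=
  if j <= n then wrel w b x e
  else j <= m /\ exists (hj : n < j) z d,
    [/\ x = ident hj z, e = ident hj d & wrel w false z d].

Lemma wident_rel_le j b (x : cell C j) e : j <= n -> wident_rel b x e = wrel w b x e.
Proof. by rewrite /wident_rel => ->. Qed.

Lemma wident_rel_gt j b x e : n < j -> wident_rel (j := j) b x e =
  (j <= m /\ exists (hj : n < j) z d,
    [/\ x = ident hj z, e = ident hj d & wrel w false z d]).
Proof. by move=> hj; rewrite /wident_rel (_ : (j <= n) = false) //; lia. Qed.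

Hypothesis hf : discrete_conduche f.

Definition wident : wcell m.
Proof.
refine (@WCell m (ident h (wbase w)) wident_rel _ _ _ _ _ _).
- move=> j b x e; case: (leqP j n) => hn;
    rewrite ?(wident_rel_le _ _ _ hn) ?(wident_rel_gt _ _ _ hn).
    move=> H; have [h' ->] := wrel_base H.
    have hj : j <= m by lia.
    by exists hj; rewrite (face_ident_le _ _ _ h').
  move=> [hj [hj' [z [d [-> _ H]]]]]; exists hj.
  have [hr hb] := wrel_base H.
  by rewrite (face_ident_gt _ _ _ hj') fmap_ident hb face_refl.
- move=> j b hj x; case: (leqP j n) => hn.
    rewrite (face_ident_le _ _ _ hn) => /wrel_total [e He].
    by exists e; rewrite wident_rel_le.
  rewrite (face_ident_gt _ _ _ hn) => hx.
  (* Totality rests on (c1): every cell over the unit is itself a unit. *)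
  have [z -> hz] := conduche_lift_ident hf hx.
  have [d hd] : exists d, wrel w false z d.
    by apply: (@wrel_total _ w n false (leqnn n)); rewrite face_refl.
  by exists (ident hn d); rewrite wident_rel_gt //; split=> //; exists hn, z, d.
- move=> j b x e e'; case: (leqP j n) => hn;
    rewrite ?(wident_rel_le _ _ _ hn) ?(wident_rel_gt _ _ _ hn).
    exact: wrel_fun.
  move=> [_ [h1 [z [d [-> -> H]]]]] [_ [h2 [z' [d' [ez -> H']]]]].
  have e0 : z = z' by rewrite -(src_ident h1 z) ez (ident_irr h2 h1) src_ident.
  by subst z'; rewrite (wrel_fun H H') (ident_irr h2 h1).
- by move=> x e; rewrite !wident_rel_gt.
- move=> j i hi b x e; case: (leqP j n) => hn;
    rewrite ?(wident_rel_le _ _ _ hn) ?(wident_rel_gt _ _ _ hn).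
    by rewrite wident_rel_le; [exact: wrel_src | lia].
  move=> [hj [h1 [z [d [-> -> H]]]]]; case: (ltngtP i n) => hin.
  + by rewrite !(src_ident_lt _ _ hin) wident_rel_le ?(ltnW hin) //; exact: wrel_src H.
  + rewrite !(src_ident_gt _ _ hin) wident_rel_gt //; split; first lia.
    by exists hin, z, d.
  by subst i; rewrite wident_rel_le // !(src_irr hi h1) !src_ident.
- move=> j i hi b x e; case: (leqP j n) => hn;
    rewrite ?(wident_rel_le _ _ _ hn) ?(wident_rel_gt _ _ _ hn).
    by rewrite wident_rel_le; [exact: wrel_tgt | lia].
  move=> [hj [h1 [z [d [-> -> H]]]]]; case: (ltngtP i n) => hin.
  + by rewrite !(tgt_ident_lt _ _ hin) wident_rel_le ?(ltnW hin) //; exact: wrel_tgt H.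
  + rewrite !(tgt_ident_gt _ _ hin) wident_rel_gt //; split; first lia.
    by exists hin, z, d.
  subst i; rewrite wident_rel_le // !(tgt_irr hi h1) !tgt_ident; exact: wrel_topE H.
Defined.

End Ident.

Section Comp.
Variables (n i : nat) (h : i < n) (w v : wcell n).

(** Faces below [i] are common to [w] and [v]; in dimension [i] the source is that of [w] and the
    target that of [v]; above, a cell over the composite is factored by (c2) and mapped factor by
    factor. *)
Definition wcomp_rel j (b : bool) (x : cell C j) (e : cell E j) : Prop :=
  if j < i then wrel w b x e
  else if j == i then wrel (if b then v else w) b x e
  else exists (hj : i < j) x1 x2 (ex : tgt hj x1 = src hj x2)
      d1 d2 (ed : tgt hj d1 = src hj d2),
    [/\ x = comp hj ex, e = comp hj ed, wrel w b x1 d1 & wrel v b x2 d2].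

Lemma wcomp_rel_ltE j b (x : cell C j) e : j < i -> wcomp_rel b x e = wrel w b x e.
Proof. by rewrite /wcomp_rel => ->. Qed.

Lemma wcomp_rel_eqE j b x e : j = i ->
  wcomp_rel (j := j) b x e = wrel (if b then v else w) b x e.
Proof.
move=> ej; rewrite /wcomp_rel (_ : (j < i) = false); last lia.
by rewrite (_ : j == i); last lia.
Qed.

Lemma wcomp_rel_gtE j b x e : i < j -> wcomp_rel (j := j) b x e =
  exists (hj : i < j) x1 x2 (ex : tgt hj x1 = src hj x2)
      d1 d2 (ed : tgt hj d1 = src hj d2),
    [/\ x = comp hj ex, e = comp hj ed, wrel w b x1 d1 & wrel v b x2 d2].
Proof. by move=> hj; rewrite /wcomp_rel (gtn_eqF hj) (_ : (j < i) = false) //; lia. Qed.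

Hypothesis hf : discrete_conduche f.
Hypothesis ewv : wface true h w = wface false h v.

Lemma wcomp_base_composable : tgt h (wbase w) = src h (wbase v).
Proof. exact: (congr1 (@wbase _) ewv). Qed.

Lemma wcomp_rel_lt j b (x : cell C j) e : j < i -> wrel w b x e -> wrel v b x e.
Proof.
move=> hj H; have : wrel (wface true h w) b x e.
  by split; [lia | rewrite (_ : (j == i) = false) //; lia].
by rewrite ewv => -[_]; rewrite (_ : (j == i) = false) //; lia.
Qed.

Lemma wcomp_rel_eq (x : cell C i) e : wrel w true x e -> wrel v false x e.
Proof.
move=> H; have : wrel (wface true h w) true x e.
  by split; rewrite ?eqxx.
by rewrite ewv => -[_]; rewrite eqxx.
Qed.

(** Both sides are the value of [v] at the i-cell where [x1] meets [x2]: the left one through [w]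
    and the equality of the shared face, the right one directly. *)
Lemma wcomp_composable j (hj : i < j) b x1 x2 d1 d2 :
  tgt hj x1 = src hj x2 -> wrel w b x1 d1 -> wrel v b x2 d2 ->
  tgt hj d1 = src hj d2.
Proof.
move=> ex H1 H2; apply: (@wrel_fun _ v i false (src hj x2)).
  by apply: wcomp_rel_eq; rewrite -ex; exact: wrel_tgt H1.
exact: wrel_src H2.
Qed.

Definition wcomp : wcell n.
Proof.
refine (@WCell n (comp h wcomp_base_composable) wcomp_rel _ _ _ _ _ _).
- move=> j b x e; case: (ltngtP j i) => hj;
    rewrite ?(wcomp_rel_ltE _ _ _ hj) ?(wcomp_rel_gtE _ _ _ hj).
  + move=> H; have [hn hx] := wrel_base H; exists hn.
    by rewrite face_comp_lt.
  + move=> [hj' [x1 [x2 [ex [d1 [d2 [ed [-> _ H1 H2]]]]]]]].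
    have [hn h1] := wrel_base H1; have [hn' h2] := wrel_base H2.
    exists hn; rewrite (fmap_comp ex (fmap_composable f ex)).
    rewrite (face_comp_gt wcomp_base_composable
      (face_composable b hn hj' wcomp_base_composable)).
    by apply: comp_congr => //; rewrite h2 (face_irr _ hn hn').
  + subst j; rewrite wcomp_rel_eqE // => H; have [hn hx] := wrel_base H; exists hn.
    by rewrite face_comp_eq hx; case: (b).
- move=> j b hn x hx; case: (ltngtP j i) => hj.
  + move: hx; rewrite face_comp_lt // => /wrel_total [d Hd].
    by exists d; rewrite wcomp_rel_ltE.
  + rewrite (face_comp_gt wcomp_base_composable
      (face_composable b hn hj wcomp_base_composable)) in hx.
    (* Totality rests on the existence half of (c2). *)
    have [x1 [x2 [ex [-> h1 h2]]]] := conduche_lift_comp hf hx.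
    have [d1 H1] := wrel_total h1; have [d2 H2] := wrel_total h2.
    have ed := wcomp_composable ex H1 H2.
    by exists (comp hj ed); rewrite wcomp_rel_gtE //; exists hj, x1, x2, ex, d1, d2, ed.
  + subst j; rewrite face_comp_eq in hx.
    have [d Hd] : exists d, wrel (if b then v else w) b x d.
      by case: b hx => /wrel_total.
    by exists d; rewrite wcomp_rel_eqE.
- move=> j b x e e'; case: (ltngtP j i) => hj;
    rewrite ?(wcomp_rel_ltE _ _ _ hj) ?(wcomp_rel_gtE _ _ _ hj).
  + exact: wrel_fun.
  + move=> [h1 [x1 [x2 [ex [d1 [d2 [ed [-> -> H1 H2]]]]]]]].
    move=> [h1' [y1 [y2 [ey [c1 [c2 [ec [exy -> K1 K2]]]]]]]].
    have eh : h1 = h1' by exact: Prop_irrelevance.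
    subst h1'.
    have [hn p1] := wrel_base H1; have [hn' p2] := wrel_base H2.
    have [kn q1] := wrel_base K1; have [kn' q2] := wrel_base K2.
    (* Single-valuedness rests on the uniqueness half of (c2). *)
    have [e1 e2] : x1 = y1 /\ x2 = y2.
      apply: (conduche_comp_inj hf exy).
        by rewrite p1 q1 (face_irr _ hn kn).
      by rewrite p2 q2 (face_irr _ hn' kn').
    subst y1 y2; apply: comp_congr; [exact: wrel_fun H1 K1|exact: wrel_fun H2 K2].
  + by subst j; rewrite !wcomp_rel_eqE //; exact: wrel_fun.
- move=> x e; case: (ltngtP n i) => hj;
    rewrite ?(wcomp_rel_ltE _ _ _ hj) ?(wcomp_rel_gtE _ _ _ hj);
    try by exfalso; lia.
  move=> [h1 [x1 [x2 [ex [d1 [d2 [ed [-> -> H1 H2]]]]]]]].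
  by exists h1, x1, x2, ex, d1, d2, ed; split=> //; exact: wrel_top.
- move=> j l hl b x e; case: (ltngtP j i) => hj;
    rewrite ?(wcomp_rel_ltE _ _ _ hj) ?(wcomp_rel_gtE _ _ _ hj).
  + by rewrite wcomp_rel_ltE; [exact: wrel_src | lia].
  + move=> [h1 [x1 [x2 [ex [d1 [d2 [ed [-> -> H1 H2]]]]]]]].
    case: (ltngtP l i) => hli.
    * by rewrite wcomp_rel_ltE // !(src_comp_lt _ hli); exact: wrel_src H1.
    * have ex' : tgt hli (src hl x1) = src hli (src hl x2).
        by rewrite (tgt_src _ _ h1) (src_src _ _ h1).
      have ed' : tgt hli (src hl d1) = src hli (src hl d2).
        by rewrite (tgt_src _ _ h1) (src_src _ _ h1).
      rewrite wcomp_rel_gtE //; exists hli, _, _, ex', _, _, ed'; split.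
      - exact: src_comp_gt.
      - exact: src_comp_gt.
      - exact: wrel_src H1.
      exact: wrel_src H2.
    * by subst l; rewrite wcomp_rel_eqE // !(src_irr hl h1) !src_comp; exact: wrel_src H1.
  + subst j; rewrite wcomp_rel_eqE // wcomp_rel_ltE //.
    (* For [b = true] the relation is that of [v] in dimension [i] but that of [w] below. The value
       that [w] gives is carried to [v] by [wcomp_rel_lt] and compared there. *)
    case: b => H; last exact: wrel_src H.
    have := wrel_src hl H; have [hn hb] := wrel_base H.
    move=> H'; have [d Hd] : exists d, wrel w false (src hl x) d.
      have hln : l < n by lia.
      have hln' : l <= n by lia.
      apply: (@wrel_total _ w l false hln').
      rewrite fmap_src hb (face_lt _ _ h) (face_lt _ _ hln) /=.
      by rewrite (src_tgt _ _ hln) (composable_src_lt _ _ wcomp_base_composable).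
    by rewrite (wrel_fun H' (wcomp_rel_lt hl Hd)).
- move=> j l hl b x e; case: (ltngtP j i) => hj;
    rewrite ?(wcomp_rel_ltE _ _ _ hj) ?(wcomp_rel_gtE _ _ _ hj).
  + by rewrite wcomp_rel_ltE; [exact: wrel_tgt | lia].
  + move=> [h1 [x1 [x2 [ex [d1 [d2 [ed [-> -> H1 H2]]]]]]]].
    case: (ltngtP l i) => hli.
    * by rewrite wcomp_rel_ltE // !(tgt_comp_lt _ hli); exact: wrel_tgt H1.
    * have ex' : tgt hli (tgt hl x1) = src hli (tgt hl x2).
        by rewrite (tgt_tgt _ _ h1) (src_tgt _ _ h1).
      have ed' : tgt hli (tgt hl d1) = src hli (tgt hl d2).
        by rewrite (tgt_tgt _ _ h1) (src_tgt _ _ h1).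
      rewrite wcomp_rel_gtE //; exists hli, _, _, ex', _, _, ed'; split.
      - exact: tgt_comp_gt.
      - exact: tgt_comp_gt.
      - exact: wrel_tgt H1.
      exact: wrel_tgt H2.
    * by subst l; rewrite wcomp_rel_eqE // !(tgt_irr hl h1) !tgt_comp; exact: wrel_tgt H2.
  + subst j; rewrite wcomp_rel_eqE // wcomp_rel_ltE //.
    case: b => H; last exact: wrel_tgt H.
    have := wrel_tgt hl H; have [hn hb] := wrel_base H.
    move=> H'; have [d Hd] : exists d, wrel w true (tgt hl x) d.
      have hln : l < n by lia.
      have hln' : l <= n by lia.
      apply: (@wrel_total _ w l true hln').
      rewrite fmap_tgt hb (face_lt _ _ h) (face_lt _ _ hln) /=.
      by rewrite (tgt_tgt _ _ hln) (composable_tgt_lt _ _ wcomp_base_composable).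
    by rewrite (wrel_fun H' (wcomp_rel_lt hl Hd)).
Defined.

End Comp.

End DependentProduct.
Arguments wrel {C D E f m} w {j} b x e.

(** * The dependent product as an omega-category, and its inverses *)

Section DependentProductCat.
Variables (C D E : omega_cat) (f : functor C D) (hf : discrete_conduche f).
Notation wcell := (wcell E f).

Lemma wface_wface c c' n j i (hj : j < n) (hi : i < j) (h : i < n)
    (w : wcell n) : wface c hi (wface c' hj w) = wface c h w.
Proof.
apply: wcell_eq => [|l b x e hl [_ [hl' H]]] /=.
  by rewrite /wface_base /=; case: c c' => [] [];
    rewrite ?(src_src _ _ h) ?(src_tgt _ _ h) ?(tgt_src _ _ h) ?(tgt_tgt _ _ h).
by split=> //; move: H; rewrite (_ : (l == j) = false) //; lia.
Qed.

Lemma wface_wident c n m (h : n < m) (w : wcell n) :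
  wface c h (wident h w hf) = w.
Proof.
apply: wcell_eq => [|l b x e hl [_]] /=.
  by rewrite /wface_base /= src_ident tgt_ident if_same.
rewrite wident_rel_le //; case: eqP => // el; subst l; exact: wrel_topE.
Qed.

Lemma wident_wident n m p (h1 : n < m) (h2 : m < p) (h : n < p) (w : wcell n) :
  wident h2 (wident h1 w hf) hf = wident h w hf.
Proof.
apply: wcell_eq => [|l b x e hl] /=; first exact: ident_ident.
case: (leqP l m) => hlm.
  rewrite wident_rel_le //=; case: (leqP l n) => hln.
    by rewrite !wident_rel_le.
  rewrite !wident_rel_gt // => -[_ H]; by split.
rewrite !wident_rel_gt //; last lia.
move=> [_ [hj [z [d [-> ->]]]]]; rewrite /= wident_rel_gt //.
move=> [_ [hj' [z' [d' [-> -> H]]]]]; split=> //.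
have hnl : n < l by lia.
by exists hnl, z', d'; split; rewrite ?ident_ident.
Qed.

Lemma wface_src_comp n i (h : i < n) (w v : wcell n)
    (e : wface true h w = wface false h v) :
  wface false h (wcomp hf e) = wface false h w.
Proof.
apply: wcell_eq => [|l b x d hl [_]] /=; first by rewrite /wface_base /= src_comp.
case: (ltngtP l i) => hli; try by exfalso; lia.
  by rewrite wcomp_rel_ltE // => H; split=> //; rewrite ltn_eqF.
by subst l; rewrite wcomp_rel_eqE // => H; split; rewrite ?eqxx.
Qed.

Lemma wface_tgt_comp n i (h : i < n) (w v : wcell n)
    (e : wface true h w = wface false h v) :
  wface true h (wcomp hf e) = wface true h v.
Proof.
apply: wcell_eq => [|l b x d hl [_]] /=; first by rewrite /wface_base /= tgt_comp.
case: (ltngtP l i) => hli; try by exfalso; lia.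
  rewrite wcomp_rel_ltE // => H; split=> //; rewrite ltn_eqF //.
  exact: wcomp_rel_lt e _ _ _ _ hli H.
by subst l; rewrite wcomp_rel_eqE // => H; split; rewrite ?eqxx.
Qed.

Lemma wface_comp_gt c n j i (hj : j < n) (hi : i < j) (h : i < n)
    (w v : wcell n) (e : wface true h w = wface false h v)
    (e' : wface true hi (wface c hj w) = wface false hi (wface c hj v)) :
  wface c hj (wcomp hf e) = wcomp hf e'.
Proof.
apply: wcell_eq => [|l b x d hl [_]] /=.
  rewrite /wface_base /=; case: c e' => e'.
    exact: tgt_comp_gt.
  exact: src_comp_gt.
case: (ltngtP l i) => hli.
- rewrite !wcomp_rel_ltE // => H; split=> //.
- rewrite !wcomp_rel_gtE // => -[h1 [x1 [x2 [ex [d1 [d2 [ed [-> -> H1 H2]]]]]]]].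
  by exists h1, x1, x2, ex, d1, d2, ed; split.
have nij : (i == j) = false by rewrite ltn_eqF.
subst l; rewrite !wcomp_rel_eqE //.
by case: b => /= H; (split; first exact: ltnW); move: H; rewrite nij.
Qed.

Lemma wcomp_assoc n i (h : i < n) (x y z : wcell n)
    (exy : wface true h x = wface false h y)
    (eyz : wface true h y = wface false h z)
    (el : wface true h (wcomp hf exy) = wface false h z)
    (er : wface true h x = wface false h (wcomp hf eyz)) :
  wcomp hf el = wcomp hf er.
Proof.
apply: wcell_eq => [|l b u d hl] /=; first exact: comp_assoc.
case: (ltngtP l i) => hli.
- by rewrite !wcomp_rel_ltE //= !wcomp_rel_ltE.
- rewrite !wcomp_rel_gtE //= => -[h1 [x1 [x2 [ex [d1 [d2 [ed [-> ->]]]]]]]].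
  rewrite wcomp_rel_gtE // => -[h2 [y1 [y2 [ey [c1 [c2 [ec [E1 E2 K1 K2]]]]]]]] H.
  have eh : h1 = h2 by exact: Prop_irrelevance.
  subst h2 x1 d1.
  have ey2 : tgt h1 y2 = src h1 x2 by rewrite -ex tgt_comp.
  have ec2 : tgt h1 c2 = src h1 d2 by rewrite -ed tgt_comp.
  have eyr : tgt h1 y1 = src h1 (comp h1 ey2) by rewrite src_comp.
  have ecr : tgt h1 c1 = src h1 (comp h1 ec2) by rewrite src_comp.
  exists h1, y1, (comp h1 ey2), eyr, c1, (comp h1 ec2), ecr; split=> //.
  + exact: comp_assoc.
  + exact: comp_assoc.
  by rewrite wcomp_rel_gtE //; exists h1, y2, x2, ey2, c2, d2, ec2.
subst l; rewrite !wcomp_rel_eqE //; case: b => //=; rewrite wcomp_rel_eqE //.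
Qed.

Lemma wcomp_identl n i (h : i < n) (x : wcell n)
    (e : wface true h (wident h (wface false h x) hf) = wface false h x) :
  wcomp hf e = x.
Proof.
apply: wcell_eq => [|l b u d hl] /=; first exact: comp_identl_eq.
case: (ltngtP l i) => hli.
- rewrite wcomp_rel_ltE //= wident_rel_le; last lia.
  by move=> [_]; rewrite ltn_eqF.
- rewrite wcomp_rel_gtE // => -[h1 [x1 [x2 [ex [d1 [d2 [ed [-> -> /=]]]]]]]].
  rewrite wident_rel_gt // => -[_ [h2 [z [c [E1 E2 _]]]]]; subst x1 d1.
  rewrite (Prop_irrelevance h2 h1) in ex ed *.
  by rewrite !comp_identl_eq.
subst l; rewrite !wcomp_rel_eqE //; case: b => //=.
by rewrite wident_rel_le // => -[_]; rewrite eqxx.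
Qed.

Lemma wcomp_identr n i (h : i < n) (x : wcell n)
    (e : wface true h x = wface false h (wident h (wface true h x) hf)) :
  wcomp hf e = x.
Proof.
apply: wcell_eq => [|l b u d hl] /=; first exact: comp_identr_eq.
case: (ltngtP l i) => hli.
- by rewrite wcomp_rel_ltE.
- rewrite wcomp_rel_gtE // => -[h1 [x1 [x2 [ex [d1 [d2 [ed [-> -> /=]]]]]]]].
  rewrite wident_rel_gt // => H -[_ [h2 [z [c [E1 E2 _]]]]]; subst x2 d2.
  rewrite (Prop_irrelevance h2 h1) in ex ed *.
  by rewrite !comp_identr_eq.
subst l; rewrite !wcomp_rel_eqE //; case: b => //=.
by rewrite wident_rel_le // => -[_]; rewrite eqxx.
Qed.

Lemma wident_wcomp n m i (h : n < m) (hn : i < n) (hm : i < m) (x y : wcell n)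
    (e : wface true hn x = wface false hn y)
    (e' : wface true hm (wident h x hf) = wface false hm (wident h y hf)) :
  wident h (wcomp hf e) hf = wcomp hf e'.
Proof.
apply: wcell_eq => [|l b u d hl] /=; first exact: ident_comp.
case: (leqP l n) => hln.
  rewrite wident_rel_le //=; case: (ltngtP l i) => hli.
  - by rewrite !wcomp_rel_ltE //= wident_rel_le.
  - rewrite !wcomp_rel_gtE // => -[h1 [x1 [x2 [ex [d1 [d2 [ed [-> -> H1 H2]]]]]]]].
    by exists h1, x1, x2, ex, d1, d2, ed; split=> //=; rewrite wident_rel_le.
  by subst l; rewrite !wcomp_rel_eqE //; case: b => /=; rewrite wident_rel_le.
rewrite wident_rel_gt // => -[_ [h1 [z [c [-> -> /=]]]]].
rewrite wcomp_rel_gtE // => -[h2 [x1 [x2 [ex [d1 [d2 [ed [-> -> H1 H2]]]]]]]].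
have hil : i < l by lia.
rewrite wcomp_rel_gtE //=.
have ex' : tgt hil (ident h1 x1) = src hil (ident h1 x2).
  by rewrite (tgt_ident_lt _ _ h2) (src_ident_lt _ _ h2).
have ed' : tgt hil (ident h1 d1) = src hil (ident h1 d2).
  by rewrite (tgt_ident_lt _ _ h2) (src_ident_lt _ _ h2).
exists hil, _, _, ex', _, _, ed'; split; try exact: ident_comp.
  by rewrite wident_rel_gt //; split=> //; exists h1, x1, d1.
by rewrite wident_rel_gt //; split=> //; exists h1, x2, d2.
Qed.

(** In [wexchange] only the left-hand bracketing is available on the factors of a lifted cell;
    globularity yields the composability proofs of the right-hand one from it. *)
Lemma exchange_of_comp (A : omega_cat) n j i (hj : j < n) (hi : i < n) :
  i < j -> forall (x y z w : cell A n) (exy : tgt hj x = src hj y)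
    (ezw : tgt hj z = src hj w)
    (el : tgt hi (comp hj exy) = src hi (comp hj ezw)),
  exists (exz : tgt hi x = src hi z) (eyw : tgt hi y = src hi w)
    (er : tgt hj (comp hi exz) = src hj (comp hi eyw)),
    comp hi el = comp hj er.
Proof.
move=> hij x y z w exy ezw el.
have exz : tgt hi x = src hi z.
  by rewrite -(tgt_comp_lt hi hij exy) el (src_comp_lt hi hij ezw).
have eyw : tgt hi y = src hi w.
  by rewrite -(composable_tgt_lt hi hij exy) exz (composable_src_lt hi hij ezw).
have a : tgt hij (tgt hj x) = src hij (tgt hj z).
  by rewrite (tgt_tgt _ _ hi) (src_tgt _ _ hi).
have b : tgt hij (src hj y) = src hij (src hj w).
  by rewrite (tgt_src _ _ hi) (src_src _ _ hi).
have er : tgt hj (comp hi exz) = src hj (comp hi eyw).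
  by rewrite (tgt_comp_gt exz a) (src_comp_gt eyw b); exact: comp_congr.
by exists exz, eyw, er; exact: exchange.
Qed.

Lemma wexchange n j i (hj : j < n) (hi : i < n) : i < j ->
  forall (x y z w : wcell n) (exy : wface true hj x = wface false hj y)
    (ezw : wface true hj z = wface false hj w)
    (exz : wface true hi x = wface false hi z)
    (eyw : wface true hi y = wface false hi w)
    (el : wface true hi (wcomp hf exy) = wface false hi (wcomp hf ezw))
    (er : wface true hj (wcomp hf exz) = wface false hj (wcomp hf eyw)),
  wcomp hf el = wcomp hf er.
Proof.
move=> hij x y z w exy ezw exz eyw el er.
apply: wcell_eq => [|l b u d hl] /=; first exact: exchange.
case: (ltngtP l i) => hli.
- by rewrite !wcomp_rel_ltE //=; try lia; rewrite !wcomp_rel_ltE //; lia.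
- rewrite wcomp_rel_gtE // => -[h1 [x1 [x2 [ex [d1 [d2 [ed [-> -> /=]]]]]]]].
  case: (ltngtP l j) => hlj.
  + rewrite !wcomp_rel_ltE //= wcomp_rel_gtE // => H1 H2.
    by exists h1, x1, x2, ex, d1, d2, ed.
  + rewrite !wcomp_rel_gtE //.
    move=> [h2 [y1 [y2 [ey [c1 [c2 [ec [E1 E1' H1 H1']]]]]]]].
    move=> [h3 [z1 [z2 [ez [b1 [b2 [eb [E2 E2' H2 H2']]]]]]]]; subst x1 x2 d1 d2.
    have eh : h2 = h3 by exact: Prop_irrelevance.
    subst h3.
    have [p1 [p2 [p3 ->]]] := exchange_of_comp hij ex.
    have [q1 [q2 [q3 ->]]] := exchange_of_comp hij ed.
    exists h2, _, _, p3, _, _, q3; split=> //=; rewrite wcomp_rel_gtE //.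
      by exists h1, y1, z1, p1, c1, b1, q1.
    by exists h1, y2, z2, p2, c2, b2, q2.
  + subst l; rewrite !wcomp_rel_eqE //.
    by case: b => H1 H2 /=; rewrite wcomp_rel_gtE //; exists h1, x1, x2, ex, d1, d2, ed.
subst l; rewrite wcomp_rel_eqE // wcomp_rel_ltE //=.
by case: b => /=; rewrite wcomp_rel_ltE // wcomp_rel_eqE.
Qed.

Definition dprod : omega_cat.
Proof.
refine (@OmegaCat wcell (@wface _ _ _ f false) (@wface _ _ _ f true)
  (fun n m h w => wident h w hf) (fun n i h x y e => wcomp hf e)
  _ _ _ _ _ _ _ _ _ _ _ _ _ _ _ _).
- by move=> *; exact: wface_wface.
- by move=> *; exact: wface_wface.
- by move=> *; exact: wface_wface.
- by move=> *; exact: wface_wface.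
- by move=> *; exact: wface_wident.
- by move=> *; exact: wface_wident.
- by move=> *; exact: wident_wident.
- by move=> *; exact: wface_src_comp.
- by move=> *; exact: wface_tgt_comp.
- by move=> *; exact: wface_comp_gt.
- by move=> *; exact: wface_comp_gt.
- by move=> *; exact: wcomp_assoc.
- by move=> *; exact: wcomp_identl.
- by move=> *; exact: wcomp_identr.
- by move=> *; exact: wident_wcomp.
- by move=> n j i hj hi hij *; exact: wexchange.
Defined.

Definition dprod_proj : functor dprod D.
Proof.
refine (@Functor dprod D (fun n (w : wcell n) => wbase w) _ _ _ _) => //.
by move=> n i h x y e e'; exact: comp_congr.
Defined.

Section Inverse.
Variables (n : nat) (w : wcell n.+1) (y' : cell D n.+1).
Hypothesis hy' : is_inverse (wbase w) y'.
Hypothesis invC : forall x : cell C n.+1, invertible x.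
Hypothesis invE : forall x : cell E n.+1, invertible x.

(** Inversion exchanges the n-source and the n-target, whence [~~ b] in dimension [n], and keeps all
    lower faces. On top cells it is conjugation: invert in [C], apply [w], invert in [E]. *)
Definition winv_rel j (b : bool) (x : cell C j) (e : cell E j) : Prop :=
  if j < n then wrel w b x e
  else if j == n then wrel w (~~ b) x e
  else exists (h : n < j) x' e',
    [/\ wrel w b x' e', inverse_at h x' x & inverse_at h e' e].

Lemma winv_rel_top b (x : cell C n.+1) (e : cell E n.+1) : winv_rel b x e <->
  exists x' e', [/\ wrel w b x' e', is_inverse x' x & is_inverse e' e].
Proof.
rewrite /winv_rel (_ : (n.+1 < n) = false); last lia.
rewrite (_ : (n.+1 == n) = false); last lia.
split=> [[h [x' [e' [H h1 h2]]]]|[x' [e' [H h1 h2]]]].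
  by exists x', e'; rewrite /is_inverse (Prop_irrelevance (ltnSn n) h).
by exists (ltnSn n), x', e'.
Qed.

Lemma winv_rel_ltE j b x e : j < n -> winv_rel (j := j) b x e = wrel w b x e.
Proof. by rewrite /winv_rel => ->. Qed.

Lemma winv_rel_eqE j b x e : j = n ->
  winv_rel (j := j) b x e = wrel w (~~ b) x e.
Proof.
move=> ej; rewrite /winv_rel (_ : (j < n) = false); last lia.
by rewrite (_ : j == n); last lia.
Qed.

Lemma winv_rel_le j b x e : winv_rel (j := j) b x e -> j <= n.+1.
Proof.
rewrite /winv_rel; case: ifP => [hj _|_]; first lia.
case: ifP => [/eqP hj _|_ [_ [x' [e' [H _ _]]]]]; first lia.
by have [] := wrel_base H.
Qed.

Lemma is_inverse_src (A : omega_cat) m (x x' : cell A m.+1) :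
  is_inverse x x' -> src (ltnSn m) x = tgt (ltnSn m) x'.
Proof. by case=> ? [e _]; rewrite e. Qed.

Lemma is_inverse_tgt (A : omega_cat) m (x x' : cell A m.+1) :
  is_inverse x x' -> tgt (ltnSn m) x = src (ltnSn m) x'.
Proof. by case=> e _; rewrite e. Qed.

Lemma face_inverse_lt (A : omega_cat) m j b (hj : j <= m.+1) (x x' : cell A m.+1) :
  j < m -> is_inverse x x' -> face b hj x = face b hj x'.
Proof.
move=> hjm hx; have hjm' : j < m.+1 by lia.
rewrite !(face_lt _ _ hjm') -!(tgt_src (ltnSn m) hjm hjm').
rewrite -!(src_src (ltnSn m) hjm hjm') (is_inverse_src hx).
by rewrite (src_tgt _ _ hjm') (tgt_tgt _ _ hjm') (src_src _ _ hjm') (tgt_src _ _ hjm').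
Qed.

Lemma leqS_cases j m : j <= m.+1 -> [\/ j < m, j = m | j = m.+1].
Proof.
by move=> hj; case: (ltngtP j m) => h; [constructor 1|constructor 3; lia|constructor 2].
Qed.

Definition winv : wcell n.+1.
Proof.
refine (@WCell _ _ _ f n.+1 y' winv_rel _ _ _ _ _ _).
- move=> j b x e H; have hj := winv_rel_le H; exists hj.
  case: (leqS_cases hj) => [hlt|ej|ej].
  + move: H; rewrite winv_rel_ltE // => H; have [h ->] := wrel_base H.
    by rewrite (face_irr _ h hj); exact: face_inverse_lt.
  + subst j; move: H; rewrite winv_rel_eqE // => H; have [h ->] := wrel_base H.
    rewrite !(face_lt _ _ (ltnSn n)).
    by case: b {H}; rewrite /= ?(is_inverse_src hy') ?(is_inverse_tgt hy').
  subst j; move: H; rewrite winv_rel_top face_refl => -[x' [e' [H hx _]]].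
  have [h] := wrel_base H; rewrite face_refl => hb.
  apply: (inverse_unique _ hy'); rewrite -hb; exact: fmap_inverse.
- move=> j b hj x hx; case: (leqS_cases hj) => [hlt|ej|ej].
  + rewrite -(face_inverse_lt _ _ hlt hy') in hx; have [e He] := wrel_total hx.
    by exists e; rewrite winv_rel_ltE.
  + subst j; have [e He] : exists e, wrel w (~~ b) x e.
      apply: (@wrel_total _ _ _ _ _ w _ _ hj); rewrite hx !(face_lt _ _ (ltnSn n)).
      by case: b {hx}; rewrite /= ?(is_inverse_src hy') ?(is_inverse_tgt hy').
    by exists e; rewrite winv_rel_eqE.
  (* The inverse of [x] lies over [wbase w], because [f] preserves inverses and inverses in [D] are
     unique; hence [w] applies to it. *)
  subst j; rewrite face_refl in hx; have [x' hx'] := invC x.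
  have [e' H] : exists e', wrel w b x' e'.
    apply: (@wrel_total _ _ _ _ _ w _ _ hj); rewrite face_refl.
    apply: (@inverse_unique _ _ y'); last exact: is_inverse_sym.
    by rewrite -hx; exact: fmap_inverse.
  have [e he] := invE e'; exists e; rewrite winv_rel_top.
  by exists x', e'; split=> //; exact: is_inverse_sym.
- move=> j b x e e' H; have hj := winv_rel_le H; move: H.
  case: (leqS_cases hj) => [hlt|ej|ej].
  + by rewrite !winv_rel_ltE //; exact: wrel_fun.
  + by rewrite !winv_rel_eqE //; exact: wrel_fun.
  subst j; rewrite !winv_rel_top => -[x1 [e1 [H1 h1 k1]]] [x2 [e2 [H2 h2 k2]]].
  have ex : x1 = x2 by apply: (@inverse_unique _ _ x); exact: is_inverse_sym.
  subst x2; rewrite -(wrel_fun H1 H2) in k2; exact: inverse_unique k1 k2.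
- move=> x e; rewrite !winv_rel_top => -[x1 [e1 [H1 h1 k1]]].
  by exists x1, e1; split=> //; exact: wrel_topE H1.
- move=> j i hi b x e H; have hj := winv_rel_le H; move: H.
  case: (leqS_cases hj) => [hlt|ej|ej].
  + rewrite !winv_rel_ltE //; [exact: wrel_src | lia].
  + subst j; rewrite winv_rel_eqE // winv_rel_ltE //; exact: wrel_src.
  subst j; rewrite winv_rel_top => -[x1 [e1 [H1 h1 k1]]].
  case: (leqS_cases (ltnW hi)) => [hlt|ej|ej].
  + rewrite winv_rel_ltE // -!(src_src (ltnSn n) hlt hi).
    rewrite -(is_inverse_tgt h1) -(is_inverse_tgt k1) !(src_tgt _ _ hi).
    exact: wrel_src H1.
  + subst i; rewrite winv_rel_eqE // !(src_irr hi (ltnSn n)).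
    by rewrite -(is_inverse_tgt h1) -(is_inverse_tgt k1); exact: wrel_tgt H1.
  by exfalso; lia.
- move=> j i hi b x e H; have hj := winv_rel_le H; move: H.
  case: (leqS_cases hj) => [hlt|ej|ej].
  + rewrite !winv_rel_ltE //; [exact: wrel_tgt | lia].
  + subst j; rewrite winv_rel_eqE // winv_rel_ltE //; exact: wrel_tgt.
  subst j; rewrite winv_rel_top => -[x1 [e1 [H1 h1 k1]]].
  case: (leqS_cases (ltnW hi)) => [hlt|ej|ej].
  + rewrite winv_rel_ltE // -!(tgt_src (ltnSn n) hlt hi).
    rewrite -(is_inverse_tgt h1) -(is_inverse_tgt k1) !(tgt_tgt _ _ hi).
    exact: wrel_tgt H1.
  + subst i; rewrite winv_rel_eqE // !(tgt_irr hi (ltnSn n)).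
    by rewrite -(is_inverse_src h1) -(is_inverse_src k1); exact: wrel_src H1.
  by exfalso; lia.
Defined.

(** A right inverse suffices: [right_inverses_invertible] makes it two-sided once every cell has
    one. *)
Lemma wcomp_winv : exists e : wface true (ltnSn n) w = wface false (ltnSn n) winv,
  wcomp hf e = wident (ltnSn n) (wface false (ltnSn n) w) hf.
Proof.
have [eyy' [ey'y [hyy' _]]] := hy'.
have e : wface true (ltnSn n) w = wface false (ltnSn n) winv.
  apply: wcell_eq => [|j b x e hj [_]]; first exact: eyy'.
  case: eqP => [ej|nj] H; split=> //.
    by subst j; rewrite /= eqxx winv_rel_eqE.
  rewrite (_ : (j == n) = false); last lia.
  by rewrite /= winv_rel_ltE //; lia.
exists e; apply: esym; apply: wcell_eq => [|j b x d hj] /=.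
  rewrite -hyy'; exact: comp_congr.
case: (leqP j n) => hjn.
  rewrite wident_rel_le // => -[_ H].
  case: (ltngtP j n) => hjn'; try by exfalso; lia.
    by rewrite wcomp_rel_ltE //; move: H; rewrite (ltn_eqF hjn').
  subst j; rewrite wcomp_rel_eqE //; move: H; rewrite eqxx; case: b => //.
  by rewrite /= winv_rel_eqE.
have ej : j = n.+1 by lia.
subst j; rewrite wident_rel_gt // => -[_ [h1 [z [c [ex ed [_ H]]]]]].
have eh : h1 = ltnSn n by exact: Prop_irrelevance.
subst h1; rewrite eqxx in H.
have [h hz] := wrel_base H; rewrite (face_lt _ _ (ltnSn n)) in hz.
have fx : f n.+1 x = comp (ltnSn n) eyy' by rewrite hyy' ex fmap_ident hz.
(* The unit [x] lies over [wbase w] composed with [y'], so (c2) splits it; the second factor is a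
   right inverse of [x1], hence its inverse. *)
have [x1 [x2 [ex12 [e12 f1 f2]]]] := conduche_lift_comp hf fx.
have sx1 : src (ltnSn n) x1 = z by rewrite -(src_comp ex12) -e12 ex src_ident.
have [x1' hx1] := invC x1.
have e2 : x2 = x1'.
  by apply: (right_inverse_unique (e := ex12) hx1); rewrite -e12 sx1.
subst x1'.
have [d1 H1] : exists d1, wrel w b x1 d1.
  by apply: (@wrel_total _ _ _ _ _ w _ _ (leqnn _)); rewrite face_refl.
have [d2 hd] := invE d1; have [ed12 [_ [ed12' _]]] := hd.
have sd1 : src (ltnSn n) d1 = c.
  by apply: (wrel_fun _ H); rewrite -sx1; exact: wrel_src H1.
rewrite wcomp_rel_gtE //; exists (ltnSn n), x1, x2, ex12, d1, d2, ed12; split=> //.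
  by rewrite ed12' sd1.
by apply/winv_rel_top; exists x1, d1.
Qed.

End Inverse.

Lemma dprod_omega_k k : is_omega_k k C -> is_omega_k k D -> is_omega_k k E ->
  is_omega_k k dprod.
Proof.
move=> hC hD hE n hn; apply: right_inverses_invertible => w.
have [y' hy'] := hD n hn (wbase w).
exists (winv hy' (hC n hn) (hE n hn)); exact: wcomp_winv.
Qed.

End DependentProductCat.

(** * Filling a parallel pair of cells of the dependent product *)

Section DependentProductCells.
Variables (C D E : omega_cat) (f : functor C D).

(** A relation in dimension at most [n] is that of one of the two n-faces, so only the top dimension
    is left to compare. *)
Lemma wcell_eqS n (w v : wcell E f n.+1) :
  wface false (ltnSn n) w = wface false (ltnSn n) v ->
  wface true (ltnSn n) w = wface true (ltnSn n) v -> wbase w = wbase v ->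
  (forall (x : cell C n.+1) e, wrel w false x e -> wrel v false x e) -> w = v.
Proof.
move=> es et eb top; apply: wcell_eq => // j b x e hj H.
case: (leqP j n) => hjn; last first.
  have ej : j = n.+1 by lia.
  by subst j; apply: (@wrel_topE _ _ _ _ _ _ false); apply/top/(wrel_topE _ H).
have H' : wrel (wface b (ltnSn n) w) b x e by split=> //; rewrite if_same.
suff : wrel (wface b (ltnSn n) v) b x e by case=> _; rewrite if_same.
by case: b H' {H}; rewrite ?es ?et.
Qed.

Section Fill.
Variables (n : nat) (w v : wcell E f n) (y : cell D n.+1).
Variable R : cell C n.+1 -> cell E n.+1 -> Prop.
Hypothesis par : forall i (h : i < n) c, wface c h w = wface c h v.
Hypothesis sy : src (ltnSn n) y = wbase w.
Hypothesis ty : tgt (ltnSn n) y = wbase v.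
Hypothesis R_base : forall x e, R x e -> f n.+1 x = y.
Hypothesis R_total : forall x, f n.+1 x = y -> exists e, R x e.
Hypothesis R_fun : forall x e e', R x e -> R x e' -> e = e'.
Hypothesis R_src : forall x e, R x e ->
  wrel w false (src (ltnSn n) x) (src (ltnSn n) e).
Hypothesis R_tgt : forall x e, R x e ->
  wrel v true (tgt (ltnSn n) x) (tgt (ltnSn n) e).

(** [R] lives in dimension [n.+1] only and is reached from a variable [j] by transport; the boundary
    comes from [w] and [v]. Such a cell is the image of a generator in [pullback_attachment]. *)
Definition wfill_rel j (b : bool) (x : cell C j) (e : cell E j) : Prop :=
  if j <= n then wrel (if b then v else w) b x e
  else exists ej : j = n.+1, R (eq_rect _ _ x _ ej) (eq_rect _ _ e _ ej).

Lemma wfill_rel_le j b (x : cell C j) e : j <= n ->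
  wfill_rel b x e = wrel (if b then v else w) b x e.
Proof. by rewrite /wfill_rel => ->. Qed.

Lemma wfill_rel_top b x e : wfill_rel (j := n.+1) b x e <-> R x e.
Proof.
rewrite /wfill_rel ltnn; split=> [[ej]|H]; last by exists erefl.
by rewrite (Prop_irrelevance ej erefl).
Qed.

Lemma wfill_rel_dim j b x e : wfill_rel (j := j) b x e -> j <= n.+1.
Proof. by rewrite /wfill_rel; case: ifP => [hj _|_ [hj _]]; lia. Qed.

(** Below dimension [n] both relations can be read off the common j-face of [w] and [v]. *)
Lemma wrel_parallel j (x : cell C j) e b : j < n -> wrel w b x e <-> wrel v b x e.
Proof.
move=> hj; have /(congr1 (fun u => wrel u b x e)) := par hj b.
rewrite /= /wface_rel leqnn eqxx => Heq; split=> H.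
  by have [] : true /\ wrel v b x e by rewrite -Heq.
by have [] : true /\ wrel w b x e by rewrite Heq.
Qed.

Lemma wfill_rel_lt j b b' (x : cell C j) e : j < n ->
  wrel (if b' then v else w) b x e -> wfill_rel b x e.
Proof.
move=> hj; rewrite wfill_rel_le; last exact: ltnW.
by case: b b' => [] [] //= /(wrel_parallel _ _ _ hj).
Qed.

Lemma face_fill b j (hj : j <= n.+1) (hn : j <= n) :
  face b hj y = face b hn (wbase (if b then v else w)).
Proof.
have hj' : j < n.+1 by lia.
rewrite (face_lt _ _ hj'); case: (le_eq_or_lt hn) => [ej|hlt].
  subst j; rewrite face_refl (tgt_irr hj' (ltnSn n)) (src_irr hj' (ltnSn n)).
  by rewrite sy ty; case: b.
rewrite (face_lt _ _ hlt) -(tgt_tgt (ltnSn n) hlt hj') -(src_src (ltnSn n) hlt hj').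
by rewrite sy ty; case: b.
Qed.

Definition wfill : wcell E f n.+1.
Proof.
refine (@WCell _ _ _ f n.+1 y wfill_rel _ _ _ _ _ _).
- move=> j b x e H; have hj := wfill_rel_dim H; exists hj; move: H.
  case: (leqP j n) => hn.
    rewrite wfill_rel_le // (face_fill _ _ hn) => H.
    by have [h ->] := wrel_base H; exact: face_irr.
  have ej : j = n.+1 by lia.
  by subst j; rewrite face_refl wfill_rel_top; exact: R_base.
- move=> j b hj x; case: (leqP j n) => hn.
    rewrite (face_fill _ _ hn) => hx.
    by have [e He] := wrel_total hx; exists e; rewrite wfill_rel_le.
  have ej : j = n.+1 by lia.
  subst j; rewrite face_refl => /R_total [e He].
  by exists e; apply/wfill_rel_top.
- move=> j b x e e' H; have hj := wfill_rel_dim H; move: H.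
  case: (leqP j n) => hn.
    by rewrite !wfill_rel_le //; exact: wrel_fun.
  have ej : j = n.+1 by lia.
  by subst j; rewrite !wfill_rel_top; exact: R_fun.
- by move=> x e; rewrite !wfill_rel_top.
- move=> j i hi b x e H; have hj := wfill_rel_dim H; move: H.
  case: (leqP j n) => hn.
    rewrite wfill_rel_le // => H; apply: (wfill_rel_lt (b' := b)); first lia.
    exact: wrel_src H.
  have ej : j = n.+1 by lia.
  subst j; rewrite wfill_rel_top => /R_src H.
  case: (ltngtP i n) => hin; try by exfalso; lia.
    rewrite -!(src_src (ltnSn n) hin hi); apply: (wfill_rel_lt (b' := false)) => //.
    exact: wrel_src H.
  by subst i; rewrite wfill_rel_le // !(src_irr hi (ltnSn n)).
- move=> j i hi b x e H; have hj := wfill_rel_dim H; move: H.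
  case: (leqP j n) => hn.
    rewrite wfill_rel_le // => H; apply: (wfill_rel_lt (b' := b)); first lia.
    exact: wrel_tgt H.
  have ej : j = n.+1 by lia.
  subst j; rewrite wfill_rel_top => /R_tgt H.
  case: (ltngtP i n) => hin; try by exfalso; lia.
    rewrite -!(tgt_tgt (ltnSn n) hin hi); apply: (wfill_rel_lt (b' := true)) => //.
    exact: wrel_tgt H.
  by subst i; rewrite wfill_rel_le // !(tgt_irr hi (ltnSn n)).
Defined.

Lemma wfill_src : wface false (ltnSn n) wfill = w.
Proof.
apply: wcell_eq => [|j b x e hj [_]]; first exact: sy.
case: eqP => [ej|nej]; first by subst j; rewrite /= wfill_rel_le //=; exact: wrel_topE.
rewrite /= wfill_rel_le //; case: b => // H; apply/wrel_parallel => //; lia.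
Qed.

Lemma wfill_tgt : wface true (ltnSn n) wfill = v.
Proof.
apply: wcell_eq => [|j b x e hj [_]]; first exact: ty.
case: eqP => [ej|nej]; first by subst j; rewrite /= wfill_rel_le //=; exact: wrel_topE.
rewrite /= wfill_rel_le //; case: b => // H; apply/wrel_parallel => //; lia.
Qed.

End Fill.

End DependentProductCells.

(** A cellwise property of an arbitrary [S], because the pullback takes three concrete forms: a
    discrete category at stage 0, [pbcat] at later stages, and [C] itself over [fid D]. *)
Definition is_pullback C D X S (f : functor C D) (j : functor X D)
    (p : functor S C) (q : functor S X) : Prop :=
  feq (fcomp f p) (fcomp j q) /\
  forall m x y, f m x = j m y -> exists! z : cell S m, p m z = x /\ q m z = y.

(** * Pullbacks along [f], and transposition *)

Section PullbackFacts.
Variables (C D X S : omega_cat) (f : functor C D) (j : functor X D).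
Variables (p : functor S C) (q : functor S X) (pb : is_pullback f j p q).

Lemma pullback_comm m z : f m (p m z) = j m (q m z).
Proof. exact: pb.1 m z. Qed.

Lemma pullback_ex m x y : f m x = j m y -> exists2 z, p m z = x & q m z = y.
Proof. by move=> /pb.2 [z [[h1 h2] _]]; exists z. Qed.

Lemma pullback_inj m z z' : p m z = p m z' -> q m z = q m z' -> z = z'.
Proof.
move=> h1 h2; have [u [_ U]] := pb.2 _ _ _ (pullback_comm z').
by rewrite -(U z' (conj erefl erefl)) -(U z (conj h1 h2)).
Qed.

(** Inverses are taken in [C] and in [X]; their images in [D] agree because inverses are unique
    there. *)
Lemma pullback_omega_k k : is_omega_k k C -> is_omega_k k X -> is_omega_k k S.
Proof.
move=> hC hX n hn z; have [x hx] := hC n hn (p _ z); have [y hy] := hX n hn (q _ z).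
have exy : f _ x = j _ y.
  apply: (@inverse_unique _ _ (f _ (p _ z))); first exact: fmap_inverse.
  by rewrite pullback_comm; exact: fmap_inverse.
have [u ux uy] := pullback_ex exy; subst x y; exists u.
have [e1 [e2 [h1 h2]]] := hx; have [e1' [e2' [h1' h2']]] := hy.
have c1 : tgt (ltnSn n) z = src (ltnSn n) u.
  by apply: pullback_inj; rewrite !fmap_src !fmap_tgt.
have c2 : tgt (ltnSn n) u = src (ltnSn n) z.
  by apply: pullback_inj; rewrite !fmap_src !fmap_tgt.
exists c1, c2; split; apply: pullback_inj; rewrite !fmap_ident ?fmap_src ?fmap_tgt.
- by rewrite -h1; exact: fmap_comp.
- by rewrite -h1'; exact: fmap_comp.
- by rewrite -h2; exact: fmap_comp.
- by rewrite -h2'; exact: fmap_comp.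
Qed.

(* Functors X -> dprod over D correspond to functors from the pullback S to E. *)
Variables (E : omega_cat) (hf : discrete_conduche f).

Section Transpose.
Variable g : functor S E.

(** On the fibre over a face of [y], this is the graph of [g] applied to the pair of [x] and that
    face, the pair being the cell [s] of the pullback. *)
Definition transpose_rel m (y : cell X m) i (b : bool) (x : cell C i)
    (e : cell E i) : Prop :=
  exists (h : i <= m) s, [/\ p i s = x, q i s = face b h y & g i s = e].

Definition transpose_cell m (y : cell X m) : wcell E f m.
Proof.
refine (@WCell _ _ _ f m (j m y) (@transpose_rel m y) _ _ _ _ _ _).
- move=> i b x e [h [s [<- qs _]]]; exists h.
  by rewrite pullback_comm qs fmap_face.
- move=> i b h x; rewrite -fmap_face => /pullback_ex [s ps qs].
  by exists (g i s), h, s.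
- move=> i b x e e' [h [s [ps qs <-]]] [h' [s' [ps' qs' <-]]].
  suff -> : s = s' by [].
  by apply: pullback_inj; rewrite ?ps ?qs ?ps' ?qs' // (face_irr _ h h').
- move=> x e [h [s [ps qs gs]]]; exists h, s; split=> //.
  by rewrite qs !face_refl.
- move=> i l hl b x e [h [s [ps qs gs]]].
  have hlm : l < m by lia.
  exists (ltnW hlm), (src hl s); split; rewrite ?fmap_src ?ps ?gs //.
  by rewrite qs (src_face _ _ _ hlm) (face_lt _ _ hlm).
- move=> i l hl b x e [h [s [ps qs gs]]].
  have hlm : l < m by lia.
  exists (ltnW hlm), (tgt hl s); split; rewrite ?fmap_tgt ?ps ?gs //.
  by rewrite qs (tgt_face _ _ _ hlm) (face_lt _ _ hlm).
Defined.

Definition transpose : functor X (dprod E hf).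
Proof.
refine (@Functor X (dprod E hf) transpose_cell _ _ _ _).
- move=> m i h y; apply: wcell_eq => /= [|l b x e hl]; first exact: fmap_src.
  move=> [h' [s [ps qs gs]]]; split=> //.
  have hm : l <= m by lia.
  by exists hm, s; split=> //; rewrite qs (face_src _ _ _ hm).
- move=> m i h y; apply: wcell_eq => /= [|l b x e hl]; first exact: fmap_tgt.
  move=> [h' [s [ps qs gs]]]; split=> //.
  have hm : l <= m by lia.
  by exists hm, s; split=> //; rewrite qs (face_tgt _ _ _ hm).
- move=> n m h y; apply/esym; apply: wcell_eq => /= [|l b x e hl].
    by rewrite fmap_ident.
  case: (leqP l n) => hln.
    rewrite wident_rel_le // => -[h' [s [ps qs gs]]].
    by exists hl, s; split=> //; rewrite qs (face_ident_le _ _ _ h').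
  rewrite wident_rel_gt // => -[_ [h1 [z [d [-> -> [h2 [s [ps qs gs]]]]]]]].
  exists hl, (ident h1 s); rewrite !fmap_ident ps qs gs; split=> //.
  by rewrite (face_ident_gt _ _ _ h1) face_refl.
- move=> n i h y1 y2 e e'; apply/esym; apply: wcell_eq => /= [|l b x d hl].
    rewrite (fmap_comp e (fmap_composable j e)); exact: comp_congr.
  case: (ltngtP l i) => hli.
  + rewrite wcomp_rel_ltE // => -[h' [s [ps qs gs]]].
    by exists hl, s; split=> //; rewrite qs face_comp_lt // (face_irr _ hl h').
  + rewrite wcomp_rel_gtE // => -[h1 [x1 [x2 [ex [d1 [d2 [ed [-> -> ]]]]]]]].
    move=> [k1 [s1 [p1 q1 g1]]] [k2 [s2 [p2 q2 g2]]].
    have es : tgt h1 s1 = src h1 s2.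
      apply: pullback_inj; rewrite !fmap_tgt !fmap_src ?p1 ?p2 ?q1 ?q2 //.
      by rewrite (face_irr _ k2 k1); exact: (face_composable _ _ _ e).
    exists hl, (comp h1 es); split.
    * by rewrite (fmap_comp es (fmap_composable p es)); exact: comp_congr.
    * rewrite (fmap_comp es (fmap_composable q es)).
      rewrite (face_comp_gt e (face_composable b hl h1 e)).
      by apply: comp_congr; rewrite ?q1 ?q2; exact: face_irr.
    by rewrite (fmap_comp es (fmap_composable g es)); exact: comp_congr.
  subst l; rewrite wcomp_rel_eqE // => H.
  have [k1 [s [ps qs gs]]] : transpose_rel (if b then y2 else y1) b x d.
    by case: b H.
  by exists k1, s; split=> //; rewrite qs face_comp_eq; case: (b).
Defined.

Lemma transpose_val m (s : cell S m) :
  wrel (transpose m (q m s)) false (p m s) (g m s).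
Proof. by exists (leqnn m), s; rewrite face_refl. Qed.

Lemma wrel_face b m i (h : i <= m) (w : cell (dprod E hf) m) c
    (x : cell C i) e :
  wrel (face b h w : wcell E f i) c x e -> wrel (w : wcell E f m) b x e.
Proof.
case: (le_eq_or_lt h) => [ei|hlt].
  by subst i; rewrite face_refl; exact: wrel_topE.
by rewrite (face_lt _ _ hlt); case: b => -[_]; rewrite eqxx.
Qed.

(** Top dimension is enough: [h] commutes with faces, so the relation of [h y] on the fibre over a
    face of [y] is the top relation of [h] at that face. *)
Lemma transpose_unique (h : functor X (dprod E hf)) :
  (forall m y, wbase (h m y) = j m y) ->
  (forall m (s : cell S m), wrel (h m (q m s)) false (p m s) (g m s)) ->
  feq h transpose.
Proof.
move=> hb hs m y; apply: esym; apply: wcell_eq => [|i b x e hi]; first by rewrite hb.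
move=> [h' [s [<- qs <-]]]; have := hs i s; rewrite qs fmap_face.
exact: wrel_face.
Qed.

End Transpose.

Section Untranspose.
Variable h : functor X (dprod E hf).
Hypothesis hb : forall m y, wbase (h m y) = j m y.

Lemma untranspose_subproof m (s : cell S m) :
  exists e, wrel (h m (q m s)) false (p m s) e.
Proof.
by apply: (wrel_total (h := leqnn m)); rewrite face_refl hb pullback_comm.
Qed.

Definition untranspose_cell m (s : cell S m) : cell E m :=
  projT1 (cid (untranspose_subproof s)).

Lemma untranspose_cellP m (s : cell S m) :
  wrel (h m (q m s)) false (p m s) (untranspose_cell s).
Proof. by rewrite /untranspose_cell; case: (cid _). Qed.

Definition untranspose : functor S E.
Proof.
refine (@Functor S E untranspose_cell _ _ _ _).
- move=> m i hi s; apply: wrel_fun (untranspose_cellP _) _.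
  rewrite !fmap_src; split=> //; rewrite eqxx.
  exact: wrel_src (untranspose_cellP s).
- move=> m i hi s; apply: wrel_fun (untranspose_cellP _) _.
  rewrite !fmap_tgt; split=> //; rewrite eqxx.
  exact: wrel_tgt (untranspose_cellP s).
- move=> n m hn s; apply: wrel_fun (untranspose_cellP _) _.
  rewrite !fmap_ident /= wident_rel_gt //; split=> //.
  by exists hn, (p n s), (untranspose_cell s); split=> //; exact: untranspose_cellP.
- move=> n i hi s1 s2 e e'; apply: wrel_fun (untranspose_cellP _) _.
  have ep := fmap_composable p e; have eq := fmap_composable q e.
  have eh := fmap_composable h eq.
  rewrite (fmap_comp e ep) (fmap_comp e eq) (fmap_comp eq eh) /= wcomp_rel_gtE //.
  exists hi, _, _, ep, _, _, e'; split=> //; exact: untranspose_cellP.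
Defined.

Lemma untransposeP m (s : cell S m) :
  wrel (h m (q m s)) false (p m s) (untranspose m s).
Proof. exact: untranspose_cellP. Qed.

End Untranspose.

End PullbackFacts.

Lemma fcompE A B C (g : functor B C) (f : functor A B) n x :
  fcomp g f n x = g n (f n x).
Proof. by []. Qed.

(** * Functors out of coproducts of free spheres and globes *)

Section FreeShapes.
Variables (k : option nat) (n : nat) (I : Type).

Lemma coprod_pik_ext (A : omega_cat) (E : omega_cat) (hE : is_omega_k k E)
    (F G : functor (coprod k (fun _ : I => pik k A)) E) :
  (forall a m x, F m (coprod_in k (fun _ : I => pik k A) a m (pik_unit k A m x)) =
    G m (coprod_in k (fun _ : I => pik k A) a m (pik_unit k A m x))) -> feq F G.
Proof.
move=> H m x.
pose g a := fcomp G (coprod_in k (fun _ : I => pik k A) a).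
have HG : feq G (copair hE g) by apply: copair_unique.
rewrite HG; apply: copair_unique => a {}m {}x.
have HL : feq (g a) (pik_lift hE (fcomp (g a) (pik_unit k A))).
  exact: pik_lift_unique.
rewrite HL; apply: pik_lift_unique => {}m {}x; exact: H.
Qed.

Lemma spheres_ext (E : omega_cat) (hE : is_omega_k k E)
    (F G : functor (spheres k n I) E) :
  (forall a, F n (spheres_cell k a (sphere_src n)) =
    G n (spheres_cell k a (sphere_src n))) ->
  (forall a, F n (spheres_cell k a (sphere_tgt n)) =
    G n (spheres_cell k a (sphere_tgt n))) -> feq F G.
Proof.
move=> Hs Ht; apply: coprod_pik_ext => // a m x.
pose u (H : functor (spheres k n I) E) :=
  fcomp (fcomp H (coprod_in k (fun _ : I => pik k (sphere n)) a))
  (pik_unit k (sphere n)).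
suff : feq (u F) (u G) by apply.
have par : parallel (u F n (sphere_src n)) (u F n (sphere_tgt n)).
  move=> i h; rewrite -!fmap_src -!fmap_tgt.
  by split; congr (u F i _); apply: gcell_inj; rewrite /= /gcut /= leqNgt h.
have [L [_ _ U]] := sphere_free par => {}m {}x.
rewrite (U (u F)) // (U (u G)) //; apply: esym; [exact: Hs | exact: Ht].
Qed.

Lemma globes_ext (E : omega_cat) (hE : is_omega_k k E)
    (F G : functor (globes k n I) E) :
  (forall a, F n (globes_cell k a (globe_top n)) =
    G n (globes_cell k a (globe_top n))) -> feq F G.
Proof.
move=> H; apply: coprod_pik_ext => // a m x.
pose u (H : functor (globes k n I) E) :=
  fcomp (fcomp H (coprod_in k (fun _ : I => pik k (globe n)) a))
  (pik_unit k (globe n)).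
suff : feq (u F) (u G) by apply.
have [L [_ U]] := globe_free (u F n (globe_top n)) => {}m {}x.
rewrite (U (u F)) // (U (u G)) //; apply: esym; exact: H.
Qed.

Lemma coprod_pik_ex (A : omega_cat) (E : omega_cat) (hE : is_omega_k k E)
    (g : I -> functor A E) :
  exists F : functor (coprod k (fun _ : I => pik k A)) E, forall a m x,
    F m (coprod_in k (fun _ : I => pik k A) a m (pik_unit k A m x)) = g a m x.
Proof.
exists (copair hE (fun a => pik_lift hE (g a))) => a m x.
apply: etrans (pik_lift_unit hE (g a) x).
exact: (@copair_in k I (fun _ : I => pik k A) E hE (fun a => pik_lift hE (g a)) a).
Qed.

Lemma spheres_ex (E : omega_cat) (hE : is_omega_k k E) (x y : I -> cell E n) :
  (forall a, parallel (x a) (y a)) ->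
  exists F : functor (spheres k n I) E,
    (forall a, F n (spheres_cell k a (sphere_src n)) = x a) /\
    (forall a, F n (spheres_cell k a (sphere_tgt n)) = y a).
Proof.
move=> par.
have ex a : exists G : functor (sphere n) E,
    G n (sphere_src n) = x a /\ G n (sphere_tgt n) = y a.
  by have [G [h1 h2 _]] := sphere_free (par a); exists G.
have [F HF] := coprod_pik_ex hE (fun a => projT1 (cid (ex a))).
by exists F; split=> a; rewrite HF; case: (cid _) => G /= [].
Qed.

Lemma globes_ex (E : omega_cat) (hE : is_omega_k k E) (x : I -> cell E n) :
  exists F : functor (globes k n I) E,
    forall a, F n (globes_cell k a (globe_top n)) = x a.
Proof.
have ex a : exists G : functor (globe n) E, G n (globe_top n) = x a.
  by have [G [h _]] := globe_free (x a); exists G.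
have [F HF] := coprod_pik_ex hE (fun a => projT1 (cid (ex a))).
by exists F => a; rewrite HF; case: (cid _).
Qed.

Lemma spheres_inclE a m (x : cell (sphere n) m) :
  spheres_incl k n I m (spheres_cell k a x) =
  globes_cell k a (sphere_incl n m x).
Proof.
rewrite /spheres_incl /coprod_map /spheres_cell; set g := (fun i : I => fcomp _ _).
apply: etrans (@copair_in k I (fun _ : I => pik k (sphere n)) _
  (coprod_omega_k k I (fun _ => pik k (globe n.+1))) g a _ _) _.
apply: (congr1 (coprod_in k (fun _ : I => pik k (globe n.+1)) a m)).
exact: (pik_lift_unit (pik_omega_k k (globe n.+1))
  (fcomp (pik_unit k (globe n.+1)) (sphere_incl n))).
Qed.

Lemma spheres_incl_src a :
  spheres_incl k n I n (spheres_cell k a (sphere_src n)) =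
  src (ltnSn n) (globes_cell k a (globe_top n.+1)).
Proof.
rewrite spheres_inclE /globes_cell -!fmap_src; congr (coprod_in _ _ _ _ _).
apply: (congr1 (pik_unit k (globe n.+1) n)).
by apply: gcell_inj; rewrite /= /gcut /= ltnn.
Qed.

Lemma spheres_incl_tgt a :
  spheres_incl k n I n (spheres_cell k a (sphere_tgt n)) =
  tgt (ltnSn n) (globes_cell k a (globe_top n.+1)).
Proof.
rewrite spheres_inclE /globes_cell -!fmap_tgt; congr (coprod_in _ _ _ _ _).
apply: (congr1 (pik_unit k (globe n.+1) n)).
by apply: gcell_inj; rewrite /= /gcut /= ltnn.
Qed.

End FreeShapes.

(** The pushout along [spheres_incl], with functors out of spheres and globes replaced by the cells
    that represent them. In this form it can be pulled back cell by cell. *)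
Definition is_attachment (k : option nat) n (I : Type) X Y
    (s t : I -> cell X n) (v : functor X Y) (c : I -> cell Y n.+1) : Prop :=
  [/\ is_omega_k k Y,
    forall a, src (ltnSn n) (c a) = v n (s a),
    forall a, tgt (ltnSn n) (c a) = v n (t a) &
    forall E, is_omega_k k E ->
      forall (g : functor X E) (d : I -> cell E n.+1),
        (forall a, src (ltnSn n) (d a) = g n (s a)) ->
        (forall a, tgt (ltnSn n) (d a) = g n (t a)) ->
      exists h : functor Y E,
        [/\ feq (fcomp h v) g, forall a, h n.+1 (c a) = d a &
          forall h' : functor Y E, feq (fcomp h' v) g ->
            (forall a, h' n.+1 (c a) = d a) -> feq h' h]].

Lemma attachment_ext k n I X Y (s t : I -> cell X n) (v : functor X Y)
    (c : I -> cell Y n.+1) (E : omega_cat) (F G : functor Y E) :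
  is_attachment k s t v c -> is_omega_k k E -> feq (fcomp F v) (fcomp G v) ->
  (forall a, F _ (c a) = G _ (c a)) -> feq F G.
Proof.
move=> [hY hs ht U] hE hv hc m x.
have [|a|h [_ _ Uh]] := U E hE (fcomp F v) (fun a => F _ (c a)).
- by move=> a; rewrite -fmap_src hs.
- by rewrite -fmap_tgt ht.
by rewrite (Uh F) // (Uh G) // => *; rewrite ?hc // hv.
Qed.

(** * Free attachment of cells as a pushout *)

Section Attachment.
Variables (k : option nat) (n : nat) (I : Type) (X Y : omega_cat).
Variables (att : functor (spheres k n I) X) (v : functor X Y).
Variable ch : functor (globes k n.+1 I) Y.

Let s a := att n (spheres_cell k a (sphere_src n)).
Let t a := att n (spheres_cell k a (sphere_tgt n)).
Let c a := ch n.+1 (globes_cell k a (globe_top n.+1)).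

Lemma attachment_of_pushout :
  is_pushout k (spheres_incl k n I) att v ch -> is_attachment k s t v c.
Proof.
move=> [hY comm U]; split=> //.
- move=> a; rewrite /c -fmap_src -spheres_incl_src; exact: comm.
- move=> a; rewrite /c -fmap_tgt -spheres_incl_tgt; exact: comm.
move=> E hE g d hs ht.
have [g' Hg'] := globes_ex hE d.
have [|h [h1 h2 h3]] := U E hE g' g.
  apply: spheres_ext => // a; rewrite !fcompE.
    by rewrite spheres_incl_src fmap_src Hg' hs.
  by rewrite spheres_incl_tgt fmap_tgt Hg' ht.
exists h; split=> // [a|h' e1 e2]; first by rewrite -Hg'; exact: h1.
apply: h3 => //; apply: globes_ext => // a; by rewrite Hg'; exact: e2.
Qed.

Lemma pushout_of_attachment :
  is_attachment k s t v c -> is_pushout k (spheres_incl k n I) att v ch.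
Proof.
move=> [hY hs ht U]; split=> //.
  apply: spheres_ext => // a; rewrite !fcompE.
    by rewrite spheres_incl_src fmap_src; exact: hs.
  by rewrite spheres_incl_tgt fmap_tgt; exact: ht.
move=> E hE g' g comm.
have [a|a|h [h1 h2 h3]] := U E hE g (fun a => g' _ (globes_cell k a (globe_top n.+1))).
- rewrite -fmap_src -spheres_incl_src; exact: comm.
- rewrite -fmap_tgt -spheres_incl_tgt; exact: comm.
exists h; split=> // [|h' e1 e2]; first by apply: globes_ext => // a; exact: h2.
by apply: h3 => // a; exact: e1.
Qed.

End Attachment.

Lemma fmap_parallel C D (f : functor C D) n (x y : cell C n) :
  parallel x y -> parallel (f n x) (f n y).
Proof.
by move=> par i h; have [es et] := par i h; rewrite -!fmap_src -!fmap_tgt es et.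
Qed.

(** * Pulling back one attachment of cells *)

Section PullbackAttachment.
Variables (C D : omega_cat) (f : functor C D) (hf : discrete_conduche f).
Variables (k : option nat) (hC : is_omega_k k C) (hD : is_omega_k k D).
Variables (n : nat) (IX IS : Type) (X Y S T : omega_cat).
Variables (jX : functor X D) (jY : functor Y D) (v : functor X Y).
Variables (s t : IX -> cell X n) (c : IX -> cell Y n.+1).
Variables (pS : functor S C) (qS : functor S X) (pT : functor T C)
  (qT : functor T Y) (u : functor S T).
Variables (s' t' : IS -> cell S n) (c' : IS -> cell T n.+1) (d : IS -> IX).
Hypothesis pbS : is_pullback f jX pS qS.
Hypothesis pbT : is_pullback f jY pT qT.
Hypothesis jv : feq (fcomp jY v) jX.
Hypothesis pu : feq (fcomp pT u) pS.
Hypothesis qu : feq (fcomp qT u) (fcomp v qS).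
Hypothesis par : forall b, parallel (s b) (t b).
Hypothesis att : is_attachment k s t v c.
Hypothesis qs' : forall a, qS n (s' a) = s (d a).
Hypothesis us' : forall a, u n (s' a) = src (ltnSn n) (c' a).
Hypothesis qt' : forall a, qS n (t' a) = t (d a).
Hypothesis ut' : forall a, u n (t' a) = tgt (ltnSn n) (c' a).
Hypothesis qc' : forall a, qT n.+1 (c' a) = c (d a).
Hypothesis c'_inj : injective c'.
Hypothesis c'_surj : forall z b, qT n.+1 z = c b -> exists2 a, c' a = z & d a = b.

(** Given [g] on [S] and images [e] of the new cells, [g] is transposed to [G], each [c b] is sent
    to a filler whose top relation takes the cells [c' a] with [d a = b] to [e a], and the extension
    to [Y] is transposed back. By [c'_surj] and [c'_inj] these [c' a] exhaust the fibre over [c b]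
    without repetition. *)
Lemma pullback_attachment : is_attachment k s' t' u c'.
Proof.
have [hY cs ct U] := att.
have hT : is_omega_k k T by exact: pullback_omega_k pbT _ hC hY.
split=> // E hE g e es et.
have hW : is_omega_k k (dprod E hf) by exact: dprod_omega_k.
pose G := transpose pbS hf g.
pose R b x y := exists a, [/\ pT _ (c' a) = x, d a = b & e a = y].
have Rs b x y : R b x y ->
    wrel (G n (s b) : wcell E f n) false (src (ltnSn n) x) (src (ltnSn n) y).
  move=> [a [<- <- <-]]; rewrite es -qs' -fmap_src -us'.
  have -> : pT n (u n (s' a)) = pS n (s' a) by exact: pu.
  exact: transpose_val.
have Rt b x y : R b x y ->
    wrel (G n (t b) : wcell E f n) true (tgt (ltnSn n) x) (tgt (ltnSn n) y).
  move=> [a [<- <- <-]]; rewrite et -qt' -fmap_tgt -ut'.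
  have -> : pT n (u n (t' a)) = pS n (t' a) by exact: pu.
  apply: (@wrel_topE _ _ _ _ _ _ false); exact: transpose_val.
have wpar b i (h : i < n) e0 : wface e0 h (G n (s b)) = wface e0 h (G n (t b)).
  by have [p1 p2] := fmap_parallel G (par b) h; case: e0.
have sy b : src (ltnSn n) (jY _ (c b)) = wbase (G n (s b)).
  by rewrite -fmap_src cs; exact: jv.
have ty b : tgt (ltnSn n) (jY _ (c b)) = wbase (G n (t b)).
  by rewrite -fmap_tgt ct; exact: jv.
have Rb b x y : R b x y -> f n.+1 x = jY _ (c b).
  by move=> [a [<- <- _]]; rewrite (pullback_comm pbT) qc'.
have Rtot b x : f n.+1 x = jY _ (c b) -> exists y, R b x y.
  move=> /(pullback_ex pbT) [z pz /c'_surj [a ca da]].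
  by exists (e a), a; rewrite ca pz.
have Rf b x y y' : R b x y -> R b x y' -> y = y'.
  move=> [a [pa da <-]] [a' [pa' da' <-]]; congr e; apply: c'_inj.
  by apply: (pullback_inj pbT); rewrite ?pa ?pa' // !qc' da da'.
pose w b := wfill (wpar b) (sy b) (ty b) (@Rb b) (@Rtot b) (@Rf b)
  (@Rs b) (@Rt b).
have [|b|h [hv hc _]] := U _ hW G w.
- by move=> b; exact: wfill_src.
- exact: wfill_tgt.
(* [h] is a functor over [D]: its projection agrees with [jY] on [X] and on the attached cells, and
   [D] is an (omega,k)-category. *)
have hb m y : wbase (h m y) = jY m y.
  have : feq (fcomp (dprod_proj E hf) h) jY.
    apply: (attachment_ext att hD) => [l x|b] /=.
      have -> : h l (v l x) = G l x by exact: hv.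
      by apply: esym; exact: jv.
    by rewrite hc.
  by apply.
exists (untranspose pbT hb); split.
- move=> m x; have := untransposeP pbT hb (u m x).
  have -> : qT m (u m x) = v m (qS m x) by exact: qu.
  have -> : h m (v m (qS m x)) = G m (qS m x) by exact: hv.
  have -> : pT m (u m x) = pS m x by exact: pu.
  move=> H; apply: wrel_fun H _; exact: transpose_val.
- move=> a; have := untransposeP pbT hb (c' a); rewrite qc' hc.
  by move=> H; apply: wrel_fun H _; apply/wfill_rel_top; exists a.
(* Uniqueness is reduced to comparing two arbitrary solutions; the untransposed functor is one of
   them. *)
suff ext (F F' : functor T E) : feq (fcomp F u) g -> feq (fcomp F' u) g ->
    (forall a, F _ (c' a) = e a) -> (forall a, F' _ (c' a) = e a) -> feq F F'.
  move=> F Fu Fc; apply: ext => //.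
  - move=> m x; have := untransposeP pbT hb (u m x).
    have -> : qT m (u m x) = v m (qS m x) by exact: qu.
    have -> : h m (v m (qS m x)) = G m (qS m x) by exact: hv.
    have -> : pT m (u m x) = pS m x by exact: pu.
    move=> H; apply: wrel_fun H _; exact: transpose_val.
  - move=> a; have := untransposeP pbT hb (c' a); rewrite qc' hc.
    by move=> H; apply: wrel_fun H _; apply/wfill_rel_top; exists a.
have tr (K : functor T E) : feq (fcomp K u) g ->
    feq (fcomp (transpose pbT hf K) v) G.
  move=> Ku; apply: transpose_unique => [m y|m x]; first exact: jv.
  have := transpose_val pbT hf K (u m x).
  have -> : qT m (u m x) = v m (qS m x) by exact: qu.
  have -> : pT m (u m x) = pS m x by exact: pu.
  by have -> : K m (u m x) = g m x by exact: Ku.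
move=> Fu F'u Fc F'c m z.
(* The comparison is made after transposition, where uniqueness for [Y] applies. At [c b] the
   boundaries are those of [G], and the top relations agree because the fibre consists of cells
   [c' a]. *)
have : feq (transpose pbT hf F) (transpose pbT hf F').
  apply: (attachment_ext att hW) => [l x|b]; first by rewrite tr // tr.
  have bs (K : functor T E) : feq (fcomp K u) g ->
      src (ltnSn n) (transpose pbT hf K _ (c b)) = G n (s b).
    by move=> Ku; rewrite -fmap_src cs; exact: (tr K Ku n (s b)).
  have bt (K : functor T E) : feq (fcomp K u) g ->
      tgt (ltnSn n) (transpose pbT hf K _ (c b)) = G n (t b).
    by move=> Ku; rewrite -fmap_tgt ct; exact: (tr K Ku n (t b)).
  apply: wcell_eqS => //.
  - exact: etrans (bs F Fu) (esym (bs F' F'u)).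
  - exact: etrans (bt F Fu) (esym (bt F' F'u)).
  move=> x y [hn [z' [pz' qz' Fz']]].
  rewrite face_refl in qz'; have [a ca da] := c'_surj qz'.
  by exists hn, z'; rewrite face_refl; split=> //; rewrite -Fz' -ca Fc F'c.
move=> eFF'; apply: wrel_fun (transpose_val pbT hf F z) _.
rewrite eFF'; exact: transpose_val.
Qed.

End PullbackAttachment.

(** * Pulling back the colimit of the stages *)

Section PullbackColimit.
Variables (C D : omega_cat) (f : functor C D) (hf : discrete_conduche f).
Variables (k : option nat) (hC : is_omega_k k C).
Variables (X : nat -> omega_cat) (v : forall n, functor (X n) (X n.+1)).
Variables (j : forall n, functor (X n) D) (col : is_seq_colimit k v j).
Variables (S : nat -> omega_cat) (u : forall n, functor (S n) (S n.+1)).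
Variables (p : forall n, functor (S n) C) (q : forall n, functor (S n) (X n)).
Hypothesis pb : forall n, is_pullback f (j n) (p n) (q n).
Hypothesis pu : forall n, feq (fcomp (p n.+1) (u n)) (p n).
Hypothesis qu : forall n, feq (fcomp (q n.+1) (u n)) (fcomp (v n) (q n)).

Lemma seq_colimit_ext (E : omega_cat) (F G : functor D E) : is_omega_k k E ->
  (forall n, feq (fcomp F (j n)) (fcomp G (j n))) -> feq F G.
Proof.
case: col => hD comm U hE HFG m x.
have [n l y|h [_ Uh]] := U E hE (fun n => fcomp F (j n)).
  by rewrite /=; congr (F l _); exact: comm.
by rewrite (Uh F) // (Uh G) // => n l y; rewrite HFG.
Qed.

Lemma pullback_id : is_pullback f (fid D) (fid C) f.
Proof.
split=> // m x y /= e; exists x; split=> //.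
by move=> x' [->].
Qed.

(** The transposes of the [g n] glue to a functor out of the colimit [D]; by [pullback_id] it
    transposes back to a functor out of [C]. *)
Lemma pullback_seq_colimit : is_seq_colimit k u p.
Proof.
have [hD comm U] := col; split=> // E hE g gu.
have hW : is_omega_k k (dprod E hf) by exact: dprod_omega_k.
(* The transposes form a cocone: restricting that of [g n.+1] along [v n] gives a functor over [D]
   with the values of [g n], and transposes are unique. *)
have [n m y|h [hj _]] := U _ hW (fun n => transpose (pb n) hf (g n)).
  have := @transpose_unique _ _ _ _ _ _ _ _ (pb n) _ hf (g n)
    (fcomp (transpose (pb n.+1) hf (g n.+1)) (v n)).
  apply=> [l x|l x]; first exact: comm.
  have := transpose_val (pb n.+1) hf (g n.+1) (u n l x).
  have -> : q n.+1 l (u n l x) = v n l (q n l x) by exact: qu.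
  have -> : p n.+1 l (u n l x) = p n l x by exact: pu.
  by have -> : g n.+1 l (u n l x) = g n l x by exact: gu.
have hb m y : wbase (h m y) = fid D m y.
  have : feq (fcomp (dprod_proj E hf) h) (fid D).
    apply: (seq_colimit_ext hD) => n l x /=.
    by have -> : h l (j n l x) = transpose (pb n) hf (g n) l x by exact: hj.
  by apply.
(* Every solution has [h] as its transpose, hence is determined by [h]. *)
have val (F : functor C E) : (forall n, feq (fcomp F (p n)) (g n)) ->
    feq (transpose pullback_id hf F) h.
  move=> HF; apply: (seq_colimit_ext hW) => n l x.
  have -> : fcomp h (j n) l x = transpose (pb n) hf (g n) l x by exact: hj.
  have := @transpose_unique _ _ _ _ _ _ _ _ (pb n) _ hf (g n)
    (fcomp (transpose pullback_id hf F) (j n)).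
  apply=> // i y; have := transpose_val pullback_id hf F (p n i y).
  rewrite (pullback_comm (pb n)) /=.
  by have -> : F i (p n i y) = g n i y by exact: HF.
exists (untranspose pullback_id hb); split.
  move=> n m y; have := untransposeP pullback_id hb (p n m y).
  rewrite (pullback_comm (pb n)).
  have -> : h m (j n m (q n m y)) = transpose (pb n) hf (g n) m (q n m y).
    exact: hj.
  by move=> H; apply: wrel_fun H _; exact: transpose_val.
move=> F HF m x; apply: wrel_fun (untransposeP pullback_id hb x).
rewrite -(val F HF); exact: (transpose_val pullback_id hf F x).
Qed.

End PullbackColimit.

Lemma pullback_lift C D X S Z (f : functor C D) (j : functor X D)
    (p : functor S C) (q : functor S X) (a : functor Z C) (b : functor Z X) :
  is_pullback f j p q -> feq (fcomp f a) (fcomp j b) ->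
  exists u : functor Z S, feq (fcomp p u) a /\ feq (fcomp q u) b.
Proof.
move=> pb hab.
have ex m (z : cell Z m) : exists s, p m s = a m z /\ q m s = b m z.
  by have [s ps qs] := pullback_ex pb (hab m z); exists s.
pose u m z := projT1 (cid (ex m z)).
have pu m z : p m (u m z) = a m z by rewrite /u; case: (cid _) => s [].
have qu m z : q m (u m z) = b m z by rewrite /u; case: (cid _) => s [].
unshelve eexists; first refine (@Functor Z S u _ _ _ _).
- move=> m i h z; apply: (pullback_inj pb); rewrite ?pu ?qu !fmap_src ?pu ?qu //.
- move=> m i h z; apply: (pullback_inj pb); rewrite ?pu ?qu !fmap_tgt ?pu ?qu //.
- move=> m i h z; apply: (pullback_inj pb); rewrite ?pu ?qu !fmap_ident ?pu ?qu //.
- move=> m i h x y e e'; apply: (pullback_inj pb); rewrite ?pu ?qu.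
    rewrite (fmap_comp e (fmap_composable a e)).
    rewrite (fmap_comp e' (fmap_composable p e')); exact: comp_congr.
  rewrite (fmap_comp e (fmap_composable b e)).
  rewrite (fmap_comp e' (fmap_composable q e')); exact: comp_congr.
by split=> m z; [exact: pu | exact: qu].
Qed.

(** * A concrete pullback: cells are compatible pairs *)

Section PullbackCat.
Variables (C D X : omega_cat) (f : functor C D) (j : functor X D).

Definition pcell m : Type := {z : cell C m * cell X m | f m z.1 = j m z.2}.

Lemma pcell_eq m (z z' : pcell m) : (sval z).1 = (sval z').1 ->
  (sval z).2 = (sval z').2 -> z = z'.
Proof.
case: z z' => [[x y] h] [[x' y'] h'] /= e1 e2; subst x' y'.
by rewrite (Prop_irrelevance h h').
Qed.

Definition psrc m i (h : i < m) (z : pcell m) : pcell i.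
Proof.
exists (src h (sval z).1, src h (sval z).2).
by rewrite /= !fmap_src (svalP z).
Defined.

Definition ptgt m i (h : i < m) (z : pcell m) : pcell i.
Proof.
exists (tgt h (sval z).1, tgt h (sval z).2).
by rewrite /= !fmap_tgt (svalP z).
Defined.

Definition pident n m (h : n < m) (z : pcell n) : pcell m.
Proof.
exists (ident h (sval z).1, ident h (sval z).2).
by rewrite /= !fmap_ident (svalP z).
Defined.

Lemma pcomp_fst m i (h : i < m) (z w : pcell m) : ptgt h z = psrc h w ->
  tgt h (sval z).1 = src h (sval w).1.
Proof. by move=> /(congr1 (fun u => (sval u).1)). Qed.

Lemma pcomp_snd m i (h : i < m) (z w : pcell m) : ptgt h z = psrc h w ->
  tgt h (sval z).2 = src h (sval w).2.
Proof. by move=> /(congr1 (fun u => (sval u).2)). Qed.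

Definition pcomp m i (h : i < m) (z w : pcell m) (e : ptgt h z = psrc h w) :
  pcell m.
Proof.
exists (comp h (pcomp_fst e), comp h (pcomp_snd e)) => /=.
rewrite (fmap_comp _ (fmap_composable f (pcomp_fst e))).
rewrite (fmap_comp _ (fmap_composable j (pcomp_snd e))).
by apply: comp_congr; [exact: (svalP z) | exact: (svalP w)].
Defined.

Definition pbcat : omega_cat.
Proof.
refine (@OmegaCat pcell psrc ptgt pident pcomp
  _ _ _ _ _ _ _ _ _ _ _ _ _ _ _ _).
- by move=> n l i hl hi h x; apply: pcell_eq; exact: src_src.
- by move=> n l i hl hi h x; apply: pcell_eq; exact: src_tgt.
- by move=> n l i hl hi h x; apply: pcell_eq; exact: tgt_src.
- by move=> n l i hl hi h x; apply: pcell_eq; exact: tgt_tgt.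
- by move=> n m h x; apply: pcell_eq; exact: src_ident.
- by move=> n m h x; apply: pcell_eq; exact: tgt_ident.
- by move=> n m p h1 h2 h x; apply: pcell_eq; exact: ident_ident.
- by move=> n i h x y e; apply: pcell_eq; exact: src_comp.
- by move=> n i h x y e; apply: pcell_eq; exact: tgt_comp.
- by move=> n l i hl hi h x y e e'; apply: pcell_eq; exact: src_comp_gt.
- by move=> n l i hl hi h x y e e'; apply: pcell_eq; exact: tgt_comp_gt.
- by move=> n i h x y z exy eyz el er; apply: pcell_eq; exact: comp_assoc.
- by move=> n i h x e; apply: pcell_eq; exact: comp_identl_eq.
- by move=> n i h x e; apply: pcell_eq; exact: comp_identr_eq.
- by move=> n m i h hn hm x y e e'; apply: pcell_eq; exact: ident_comp.
- by move=> n l i hl hi hil x y z w exy ezw exz eyw el er; apply: pcell_eq;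
    exact: exchange.
Defined.

Definition pbcat_fst : functor pbcat C.
Proof.
refine (@Functor pbcat C (fun m (z : pcell m) => (sval z).1) _ _ _ _) => //.
by move=> n i h x y e e'; exact: comp_congr.
Defined.

Definition pbcat_snd : functor pbcat X.
Proof.
refine (@Functor pbcat X (fun m (z : pcell m) => (sval z).2) _ _ _ _) => //.
by move=> n i h x y e e'; exact: comp_congr.
Defined.

Lemma pbcat_pullback : is_pullback f j pbcat_fst pbcat_snd.
Proof.
split=> [m z|m x y e]; first exact: svalP z.
exists (exist _ (x, y) e); split=> // z [zx zy].
by apply: pcell_eq; rewrite /= -?zx -?zy.
Qed.

End PullbackCat.

(** * Functors out of a discrete category *)

Section Discrete.
Variables (A : Type) (E : omega_cat).

Definition discrete_functor (c : A -> cell E 0) : functor (discrete A) E.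
Proof.
refine (@Functor (discrete A) E (fun n a => idle (leq0n n) (c a)) _ _ _ _).
- by move=> n i h x; rewrite (src_idle_ge _ _ (leq0n i)).
- by move=> n i h x; rewrite (tgt_idle_ge _ _ (leq0n i)).
- by move=> n m h x; rewrite (ident_idle _ _ (leq0n m)).
move=> n i h x y /= e; subst y => e'.
have ex : ident h (idle (leq0n i) (c x)) = idle (leq0n n) (c x).
  exact: ident_idle.
have e2 : tgt h (ident h (idle (leq0n i) (c x))) = src h (idle (leq0n n) (c x)).
  by rewrite ex.
rewrite -[LHS](comp_identl_eq e2); exact: comp_congr.
Defined.

Lemma discrete_functorE (F : functor (discrete A) E) n (a : A) :
  F n a = idle (leq0n n) (F 0 a).
Proof.
case: n => [|n]; first by rewrite idle_refl.
by rewrite (idle_lt _ (ltn0Sn n)) -fmap_ident.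
Qed.

Lemma idle_inj n m (h : n <= m) (x y : cell E n) : idle h x = idle h y -> x = y.
Proof.
case: (le_eq_or_lt h) => [e|hlt]; first by subst m; rewrite !idle_refl.
by rewrite !(idle_lt _ hlt) => /(congr1 (src hlt)); rewrite !src_ident.
Qed.

End Discrete.

Lemma discrete_omega_k k A : is_omega_k k (discrete A).
Proof. by move=> n _ x; exists x, erefl, erefl. Qed.

(** * Functors out of a free category, built stage by stage *)

Section Polygraphs.
Variables (k : option nat) (Q : polygraph k).

Definition gen_charact n (b : gen Q n.+1) : cell (skel Q n.+1) n.+1 :=
  charact Q n n.+1 (globes_cell k b (globe_top n.+1)).

Lemma skel_attachment n :
  is_attachment k (@gen_src k Q n) (@gen_tgt k Q n) (skel_incl Q n)
    (@gen_charact n).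
Proof.
have -> : @gen_src k Q n =
    fun a => attach Q n n (spheres_cell k a (sphere_src n)).
  by apply/funext => a; rewrite attach_src.
have -> : @gen_tgt k Q n =
    fun a => attach Q n n (spheres_cell k a (sphere_tgt n)).
  by apply/funext => a; rewrite attach_tgt.
exact: attachment_of_pushout (skel_pushout Q n).
Qed.

Lemma skel_omega_k n : is_omega_k k (skel Q n).
Proof.
case: n => [|n]; first exact: discrete_omega_k.
by case: (skel_attachment n).
Qed.

Lemma free_cat_omega_k : is_omega_k k (free_cat Q).
Proof. by case: (free_cat_colimit Q). Qed.

Lemma free_cat_in_incl n m x :
  free_cat_in Q n.+1 m (skel_incl Q n m x) = free_cat_in Q n m x.
Proof. by case: (free_cat_colimit Q) => _ H _; exact: H. Qed.

Lemma gen_cellS n (b : gen Q n.+1) :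
  gen_cell b = free_cat_in Q n.+1 n.+1 (gen_charact b).
Proof. by []. Qed.

Lemma gen_cell_src n (b : gen Q n.+1) :
  src (ltnSn n) (gen_cell b) = free_cat_in Q n n (gen_src b).
Proof.
rewrite gen_cellS -fmap_src; have [_ -> _ _] := skel_attachment n.
exact: free_cat_in_incl.
Qed.

Lemma gen_cell_tgt n (b : gen Q n.+1) :
  tgt (ltnSn n) (gen_cell b) = free_cat_in Q n n (gen_tgt b).
Proof.
rewrite gen_cellS -fmap_tgt; have [_ _ -> _] := skel_attachment n.
exact: free_cat_in_incl.
Qed.

(** The boundary of the image of a generator depends on the values at earlier stages, so [fill] must
    answer for every parallel pair, and the conclusion leaves that pair unspecified. *)
Lemma free_cat_map_ex (E : omega_cat) (hE : is_omega_k k E)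
    (c : gen Q 0 -> cell E 0)
    (fill : forall n, gen Q n.+1 -> forall x y : cell E n, cell E n.+1) :
  (forall n b (x y : cell E n), parallel x y ->
    src (ltnSn n) (fill n b x y) = x /\ tgt (ltnSn n) (fill n b x y) = y) ->
  exists F : functor (free_cat Q) E,
    (forall b : gen Q 0, F 0 (gen_cell b) = c b) /\
    forall n (b : gen Q n.+1), exists x y, F n.+1 (gen_cell b) = fill n b x y.
Proof.
move=> Hfill.
have step n (g : functor (skel Q n) E) : exists h : functor (skel Q n.+1) E,
    feq (fcomp h (skel_incl Q n)) g /\
    forall b, exists x y, h n.+1 (gen_charact b) = fill n b x y.
  have [_ _ _ U] := skel_attachment n.
  have par b := fmap_parallel g (gen_parallel b).
  have [b|b|h [h1 h2 _]] := U E hE g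
    (fun b => fill n b (g n (gen_src b)) (g n (gen_tgt b))).
  - by have [] := Hfill n b _ _ (par b).
  - by have [] := Hfill n b _ _ (par b).
  by exists h; split=> // b; exists (g n (gen_src b)), (g n (gen_tgt b)).
pose G := nat_rect (fun n => functor (skel Q n) E) (discrete_functor c)
  (fun n g => projT1 (cid (step n g))).
have GS n : feq (fcomp (G n.+1) (skel_incl Q n)) (G n).
  exact: (proj1 (projT2 (cid (step n (G n))))).
have Gc n b : exists x y, G n.+1 n.+1 (gen_charact b) = fill n b x y.
  exact: (proj2 (projT2 (cid (step n (G n)))) b).
have [_ _ U] := free_cat_colimit Q.
have [F [HF _]] := U E hE G GS.
exists F; split=> [b|n b].
  have -> : F 0 (gen_cell b) = G 0 0 b by exact: HF.
  by rewrite /G /= idle_refl.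
have [x [y e]] := Gc n b; exists x, y; rewrite -e; exact: HF.
Qed.

End Polygraphs.

(** * A test category that separates n-generators *)

Section FilledEilenbergMacLane.
Variable n : nat.

(* The Eilenberg-MacLane category K(Z/2, n) with a unique (n+1)-cell added
   between any two n-cells; for m > n, an m-cell is given by its n-source and
   n-target. *)
Definition km_ok (m : nat) (p : bool * bool) : bool :=
  ((m < n) ==> (p == (false, false))) && ((m == n) ==> (p.1 == p.2)).

Definition km_cell (m : nat) : Type := {p : bool * bool | km_ok m p}.

Definition km_cut (b : bool) (i : nat) (p : bool * bool) : bool * bool :=
  if i < n then (false, false)
  else if i == n then (if b then (p.2, p.2) else (p.1, p.1)) else p.

(** For [i < n] this is addition in Z/2 in both coordinates; for [i = n] it joins the n-source of
    [p] to the n-target of [q]; for [i > n] composable cells are equal as pairs. *)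
Definition km_mul (i : nat) (p q : bool * bool) : bool * bool :=
  if i < n then (p.1 (+) q.1, p.2 (+) q.2)
  else if i == n then (p.1, q.2) else p.

Lemma km_cut_ok b m i (h : i < m) (p : km_cell m) : km_ok i (km_cut b i (sval p)).
Proof.
case: p => [[x y] /= _]; rewrite /km_ok /km_cut.
by case: (ltngtP i n) => //= _; case: b; rewrite /= eqxx.
Qed.

Definition km_face b m i (h : i < m) (p : km_cell m) : km_cell i :=
  exist (km_ok i) _ (km_cut_ok b h p).

Lemma km_ident_ok l m (h : l < m) (p : km_cell l) : km_ok m (sval p).
Proof.
case: p => [[x y]] /=; rewrite /km_ok /=.
case: (ltngtP m n) => hm; case: (ltngtP l n) => hl //=; try lia.
by case: x y => [] [].
Qed.

Definition km_ident l m (h : l < m) (p : km_cell l) : km_cell m :=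
  exist (km_ok m) _ (km_ident_ok h p).

Lemma km_mul_ok m i (h : i < m) (p q : km_cell m) :
  km_ok m (km_mul i (sval p) (sval q)).
Proof.
case: p q => [[x y] /= hp] [[z t] /= hq]; move: hp hq; rewrite /km_ok /km_mul /=.
case: (ltngtP m n) => hm; case: (ltngtP i n) => hi //=; try lia;
  by case: x y z t => [] [] [] [].
Qed.

Definition km_comp m i (h : i < m) (p q : km_cell m)
    (_ : km_face true h p = km_face false h q) : km_cell m :=
  exist (km_ok m) _ (km_mul_ok h p q).

Lemma km_eq m (p q : km_cell m) : sval p = sval q -> p = q.
Proof. exact: val_inj. Qed.

Lemma km_compP m i (h : i < m) (p q : km_cell m) :
  km_face true h p = km_face false h q ->
  km_cut true i (sval p) = km_cut false i (sval q).
Proof. exact: (congr1 sval). Qed.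

Definition km : omega_cat.
Proof.
refine (@OmegaCat km_cell (km_face false) (km_face true) km_ident km_comp
  _ _ _ _ _ _ _ _ _ _ _ _ _ _ _ _).
- move=> m j i hj hi h [[x y] hx]; apply: km_eq; rewrite /= /km_cut /=.
  by case: (ltngtP i n) => hin; case: (ltngtP j n) => hjn //; lia.
- move=> m j i hj hi h [[x y] hx]; apply: km_eq; rewrite /= /km_cut /=.
  by case: (ltngtP i n) => hin; case: (ltngtP j n) => hjn //; lia.
- move=> m j i hj hi h [[x y] hx]; apply: km_eq; rewrite /= /km_cut /=.
  by case: (ltngtP i n) => hin; case: (ltngtP j n) => hjn //; lia.
- move=> m j i hj hi h [[x y] hx]; apply: km_eq; rewrite /= /km_cut /=.
  by case: (ltngtP i n) => hin; case: (ltngtP j n) => hjn //; lia.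
- move=> l m h [[x y] hx]; apply: km_eq; move: hx; rewrite /= /km_cut /km_ok /=.
  case: (ltngtP l n) => //= _; first by move=> /andP[/eqP ->].
  by move=> /eqP ->.
- move=> l m h [[x y] hx]; apply: km_eq; move: hx; rewrite /= /km_cut /km_ok /=.
  case: (ltngtP l n) => //= _; first by move=> /andP[/eqP ->].
  by move=> /eqP ->.
- by move=> l m p h1 h2 h x; apply: km_eq.
- move=> m i h [[x y] hx] [[z t] hz] e; apply: km_eq; have := km_compP e.
  rewrite /= /km_cut /km_mul /=; by case: (ltngtP i n).
- move=> m i h [[x y] hx] [[z t] hz] e; apply: km_eq; have := km_compP e.
  rewrite /= /km_cut /km_mul /=; by case: (ltngtP i n).
- move=> m j i hj hi h [[x y] hx] [[z t] hz] e e'; apply: km_eq; have := km_compP e.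
  rewrite /= /km_cut /km_mul /=.
  by case: (ltngtP i n) => hin; case: (ltngtP j n) => hjn //; lia.
- move=> m j i hj hi h [[x y] hx] [[z t] hz] e e'; apply: km_eq; have := km_compP e.
  rewrite /= /km_cut /km_mul /=.
  by case: (ltngtP i n) => hin; case: (ltngtP j n) => hjn //; lia.
- move=> m i h [[x y] hx] [[z t] hz] [[u v] hu] exy eyz el er; apply: km_eq => /=.
  by rewrite /km_mul /=; case: (ltngtP i n) => //= _; rewrite !addbA.
- move=> m i h [[x y] hx] e; apply: km_eq; rewrite /= /km_mul /km_cut /=.
  by case: (ltngtP i n).
- move=> m i h [[x y] hx] e; apply: km_eq; rewrite /= /km_mul /km_cut /=.
  by case: (ltngtP i n) => //= _; rewrite !addbF.
- by move=> l m i h hl hm x y e e'; apply: km_eq.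
move=> m j i hj hi hij x y z w exy ezw exz eyw el er; apply: km_eq.
have := km_compP exy; have := km_compP exz.
rewrite /= /km_mul /km_cut.
case: (sval x) (sval y) (sval z) (sval w) => [a a'] [b b'] [c c'] [d d'] /=.
case: (ltngtP i n) => hin; case: (ltngtP j n) => hjn //=; try lia.
by rewrite (addbACA a) (addbACA a').
Defined.

Lemma km_omega_k k : is_omega_k k km.
Proof.
move=> m _; apply: right_inverses_invertible => -[[x y] hx].
(* For [m < n] a cell is its own inverse, addition being in Z/2; for [m = n] inversion exchanges
   source and target; for [m > n] the cell is a unit. *)
have hy : km_ok m.+1 (if m == n then (y, x) else (x, y)).
  case: eqP => [->|_] //; have [h1 h2] : (n.+1 < n) = false /\ (n.+1 == n) = false by lia.
  by rewrite /km_ok h1 h2.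
pose z : km_cell m.+1 := exist (km_ok m.+1) _ hy.
have e : km_face true (ltnSn m) (exist _ (x, y) hx) = km_face false (ltnSn m) z.
  apply: km_eq; rewrite /= /km_cut /=; case: (ltngtP m n) => //=.
exists z, e; apply: km_eq; rewrite /= /km_mul /km_cut /=.
by case: (ltngtP m n) => //= _; rewrite !addbb.
Qed.

Lemma km_const_ok m b : km_ok m (if m < n then (false, false) else (b, b)).
Proof. by rewrite /km_ok; case: (ltngtP m n) => //= _; rewrite eqxx. Qed.

Definition km_const m b : km_cell m :=
  exist (km_ok m) _ (km_const_ok m b).

(** The value for [m < n] is a default that keeps the definition total; [km_fill] calls [km_pair]
    from dimension [n] on. *)
Lemma km_pair_ok m (p q : km_cell m) :
  km_ok m.+1 (if m < n then (false, false) else ((sval p).1, (sval q).2)).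
Proof.
case: p q => [[x y] _] [[z t] _] /=; rewrite /km_ok.
case: (ltnP m n) => hm /=; first by rewrite !eqxx !implybT.
have [h1 h2] : (m.+1 < n) = false /\ (m.+1 == n) = false by lia.
by rewrite h1 h2.
Qed.

Definition km_pair m (p q : km_cell m) : km_cell m.+1 :=
  exist (km_ok m.+1) _ (km_pair_ok p q).

(** For [m.+1 = n] the label [b] is the class of the filler in Z/2; for [m.+1 < n] there is a single
    cell; from [m = n] on the boundary determines the filler. *)
Definition km_fill m (b : bool) (p q : km_cell m) : km_cell m.+1 :=
  if m < n then km_const m.+1 b else km_pair p q.

Lemma km_cell_lt m (p : km_cell m) : m < n -> sval p = (false, false).
Proof. by case: p => [p /= /andP[/implyP h _]] /h /eqP. Qed.

Lemma km_cell_diag m (p : km_cell m) : m = n -> (sval p).1 = (sval p).2.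
Proof. by case: p => [p /= /andP[_ /implyP h]] /eqP /h /eqP. Qed.

Lemma km_fillP m b (p q : km_cell m) : @parallel km m p q ->
  km_face false (ltnSn m) (km_fill b p q) = p /\
  km_face true (ltnSn m) (km_fill b p q) = q.
Proof.
move=> par.
(* Above dimension [n] a cell is given by its n-source and n-target, so parallel cells are equal and
   the filler is a unit. *)
have par' : n < m -> sval p = sval q.
  move=> h; have [/(congr1 sval) es /(congr1 sval) et] := par n h.
  move: es et; rewrite /= /km_cut /= ltnn eqxx.
  by case: (sval p) (sval q) => [x y] [z t] /= [e1 _] [e2 _]; rewrite e1 e2.
rewrite /km_fill; case: (ltngtP m n) => hm.
- by split; apply: km_eq; rewrite [RHS]km_cell_lt //= /km_cut hm.
- have e := par' hm; have [h1 h2] : (m < n) = false /\ (m == n) = false by lia.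
  by split; apply: km_eq; rewrite /= /km_cut h1 h2 -?e; case: (sval p).
have [h1 h2] : (m < n) = false /\ (m == n) = true by lia.
have ep := km_cell_diag p hm; have eq := km_cell_diag q hm.
split; apply: km_eq; rewrite /= /km_cut h1 h2.
  by case: (sval p) ep => x y /= <-.
by case: (sval q) eq => x y /= <-.
Qed.

End FilledEilenbergMacLane.

(** The indicator function of [a] on n-generators extends to a functor to [km n], where boundaries
    of n-cells carry no information and parallel pairs can always be filled. Its values distinguish
    [a] from any other n-generator. *)
Lemma gen_cell_inj k (Q : polygraph k) n : injective (@gen_cell k Q n).
Proof.
move=> a b eab.
(* Defined in every dimension, since [free_cat_map_ex] asks for a filler for all generators; only
   its values in dimension [n] are read off. *)
pose delta m (c : gen Q m) : bool :=
  `[< exists e : m = n, eq_rect m (gen Q) c n e = a >].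
have deltaE (c : gen Q n) : delta n c = `[< c = a >].
  apply: asbool_equiv_eq; split=> [[e]|->]; last by exists erefl.
  by rewrite (Prop_irrelevance e erefl).
have [|F [F0 FS]] := @free_cat_map_ex k Q (km n) (@km_omega_k n k)
  (fun c => km_const n 0 (delta 0 c))
  (fun m c (x y : cell (km n) m) => km_fill (delta m.+1 c) x y).
  by move=> m c x y; exact: km_fillP.
have HF m (c : gen Q m) : m = n ->
    sval (F m (gen_cell c)) = (delta m c, delta m c).
  case: m c => [|m] c e; first by rewrite F0 /= -e ltnn.
  have [x [y ->]] := FS m c.
  have [h1 h2] : (m < n) = true /\ (m.+1 < n) = false by lia.
  by rewrite /km_fill h1 /= h2.
have := HF n b erefl; rewrite -eab HF // !deltaE => -[].
rewrite (asboolT (erefl a)) => /esym/asboolP //.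
Qed.

(** * The polygraph pulled back along [f] *)

Section PullbackPolygraph.
Variables (k : option nat) (Q : polygraph k) (C : omega_cat).
Variables (f : functor C (free_cat Q)) (hf : discrete_conduche f).
Hypothesis hC : is_omega_k k C.

Definition pgen n : Type := {a : cell C n | exists b : gen Q n, f n a = gen_cell b}.

Definition pgen_map n (a : pgen n) : gen Q n := projT1 (cid (svalP a)).

Lemma pgen_mapP n (a : pgen n) : f n (sval a) = gen_cell (pgen_map a).
Proof. by rewrite /pgen_map; case: (cid _). Qed.

Lemma pgen_eq n (a a' : pgen n) : sval a = sval a' -> a = a'.
Proof.
case: a a' => [a h] [a' h'] /= e; subst a'.
by rewrite (Prop_irrelevance h h').
Qed.

(** [pgen_map] picks some generator of [Q]; injectivity of [gen_cell] makes it the only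
    candidate. *)
Lemma pgen_map_eq n (a : pgen n) b : f n (sval a) = gen_cell b -> pgen_map a = b.
Proof. by rewrite pgen_mapP => /gen_cell_inj. Qed.

Definition pstage n : omega_cat := pbcat f (free_cat_in Q n.+1).
Definition pskel n : omega_cat := skeleton (pgen 0) pstage n.

Definition pskel_fst n : functor (pskel n) C :=
  match n with
  | 0 => discrete_functor (fun a : pgen 0 => sval a)
  | n'.+1 => pbcat_fst f (free_cat_in Q n'.+1)
  end.

Definition pskel_snd n : functor (pskel n) (skel Q n) :=
  match n with
  | 0 => discrete_functor (E := discrete (gen Q 0)) (@pgen_map 0)
  | n'.+1 => pbcat_snd f (free_cat_in Q n'.+1)
  end.

Lemma discrete_idle A n m (h : n <= m) (a : A) : idle (C := discrete A) h a = a.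
Proof.
case: (le_eq_or_lt h) => [e|hlt]; last by rewrite (idle_lt _ hlt).
by subst m; rewrite idle_refl.
Qed.

(** Stage 0 must be the discrete category on [pgen 0], not [pbcat]. It is a pullback since, by (c1),
    a cell of [C] over a unit on a 0-generator is the unit on a 0-cell over that generator. *)
Lemma pskel_pullback n :
  is_pullback f (free_cat_in Q n) (pskel_fst n) (pskel_snd n).
Proof.
case: n => [|n]; last exact: pbcat_pullback.
split=> [m a|m x b e] /=.
  rewrite (@discrete_idle (gen Q 0)) fmap_idle (discrete_functorE (free_cat_in Q 0)).
  congr (idle _ _); exact: pgen_mapP.
have [z hz fz] : exists2 z, x = idle (leq0n m) z & f 0 z = gen_cell (b : gen Q 0).
  rewrite (discrete_functorE (free_cat_in Q 0)) in e.
  case: m x b e => [|m] x b e; first by exists x; rewrite ?idle_refl // e idle_refl.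
  rewrite (idle_lt _ (ltn0Sn m)) in e.
  have [z -> hz] := conduche_lift_ident hf e.
  by exists z => //; rewrite (idle_lt _ (ltn0Sn m)).
pose a : pgen 0 := exist _ z (ex_intro _ _ fz).
exists a; split.
  split; first by rewrite hz.
  by rewrite (@discrete_idle (gen Q 0)); exact: pgen_map_eq.
move=> a' [ha' _]; apply: pgen_eq; apply: esym.
by rewrite hz in ha'; exact: idle_inj ha'.
Qed.

Lemma pskel_omega_k n : is_omega_k k (pskel n).
Proof. exact: pullback_omega_k (pskel_pullback n) _ hC (@skel_omega_k k Q n). Qed.

(** A generator must have its source in the n-th stage: it is the pair of its source in [C] and the
    source of the generator of [Q] below it, which agree in [free_cat Q] by [gen_cell_src]. *)
Lemma pgen_src_subproof n (a : pgen n.+1) : exists z : cell (pskel n) n,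
  pskel_fst n n z = src (ltnSn n) (sval a) /\
  pskel_snd n n z = gen_src (pgen_map a).
Proof.
have [|z h1 h2] := @pullback_ex _ _ _ _ _ _ _ _ (pskel_pullback n) n
    (src (ltnSn n) (sval a)) (gen_src (pgen_map a)); last by exists z.
by rewrite fmap_src pgen_mapP gen_cell_src.
Qed.

Lemma pgen_tgt_subproof n (a : pgen n.+1) : exists z : cell (pskel n) n,
  pskel_fst n n z = tgt (ltnSn n) (sval a) /\
  pskel_snd n n z = gen_tgt (pgen_map a).
Proof.
have [|z h1 h2] := @pullback_ex _ _ _ _ _ _ _ _ (pskel_pullback n) n
    (tgt (ltnSn n) (sval a)) (gen_tgt (pgen_map a)); last by exists z.
by rewrite fmap_tgt pgen_mapP gen_cell_tgt.
Qed.

Lemma pgen_charact_subproof n (a : pgen n.+1) :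
  exists z : cell (pskel n.+1) n.+1,
    pskel_fst n.+1 n.+1 z = sval a /\
    pskel_snd n.+1 n.+1 z = gen_charact (pgen_map a).
Proof.
have [|z h1 h2] := @pullback_ex _ _ _ _ _ _ _ _ (pskel_pullback n.+1) n.+1
    (sval a) (gen_charact (pgen_map a)); last by exists z.
by rewrite pgen_mapP gen_cellS.
Qed.

Definition pgen_src n (a : pgen n.+1) : cell (pskel n) n :=
  projT1 (cid (pgen_src_subproof a)).
Definition pgen_tgt n (a : pgen n.+1) : cell (pskel n) n :=
  projT1 (cid (pgen_tgt_subproof a)).
Definition pgen_charact n (a : pgen n.+1) : cell (pskel n.+1) n.+1 :=
  projT1 (cid (pgen_charact_subproof a)).

Lemma pgen_srcP n (a : pgen n.+1) :
  pskel_fst n n (pgen_src a) = src (ltnSn n) (sval a) /\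
  pskel_snd n n (pgen_src a) = gen_src (pgen_map a).
Proof. exact: (projT2 (cid (pgen_src_subproof a))). Qed.

Lemma pgen_tgtP n (a : pgen n.+1) :
  pskel_fst n n (pgen_tgt a) = tgt (ltnSn n) (sval a) /\
  pskel_snd n n (pgen_tgt a) = gen_tgt (pgen_map a).
Proof. exact: (projT2 (cid (pgen_tgt_subproof a))). Qed.

Lemma pgen_charactP n (a : pgen n.+1) :
  pskel_fst n.+1 n.+1 (pgen_charact a) = sval a /\
  pskel_snd n.+1 n.+1 (pgen_charact a) = gen_charact (pgen_map a).
Proof. exact: (projT2 (cid (pgen_charact_subproof a))). Qed.

Lemma pgen_parallel n (a : pgen n.+1) : parallel (pgen_src a) (pgen_tgt a).
Proof.
move=> i h; have hi : i < n.+1 by lia.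
have [s1 s2] := pgen_srcP a; have [t1 t2] := pgen_tgtP a.
have [es et] := gen_parallel (pgen_map a) h.
split; apply: (pullback_inj (pskel_pullback n)).
- by rewrite !fmap_src s1 t1 (src_src _ _ hi) (src_tgt _ _ hi).
- by rewrite !fmap_src s2 t2.
- by rewrite !fmap_tgt s1 t1 (tgt_src _ _ hi) (tgt_tgt _ _ hi).
- by rewrite !fmap_tgt s2 t2.
Qed.

Lemma pattach_subproof n : exists F : functor (spheres k n (pgen n.+1)) (pskel n),
  (forall a, F n (spheres_cell k a (sphere_src n)) = pgen_src a) /\
  (forall a, F n (spheres_cell k a (sphere_tgt n)) = pgen_tgt a).
Proof. apply: spheres_ex; [exact: pskel_omega_k | exact: pgen_parallel]. Qed.

Definition pattach n : functor (spheres k n (pgen n.+1)) (pskel n) :=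
  projT1 (cid (pattach_subproof n)).

Lemma pattach_src n (a : pgen n.+1) :
  pattach n n (spheres_cell k a (sphere_src n)) = pgen_src a.
Proof. by rewrite /pattach; case: (cid _) => F []. Qed.

Lemma pattach_tgt n (a : pgen n.+1) :
  pattach n n (spheres_cell k a (sphere_tgt n)) = pgen_tgt a.
Proof. by rewrite /pattach; case: (cid _) => F []. Qed.

Lemma pcharact_subproof n :
  exists F : functor (globes k n.+1 (pgen n.+1)) (pskel n.+1),
    forall a, F n.+1 (globes_cell k a (globe_top n.+1)) = pgen_charact a.
Proof. apply: globes_ex; exact: pskel_omega_k. Qed.

Definition pcharact n : functor (globes k n.+1 (pgen n.+1)) (pskel n.+1) :=
  projT1 (cid (pcharact_subproof n)).

Lemma pcharactP n (a : pgen n.+1) :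
  pcharact n n.+1 (globes_cell k a (globe_top n.+1)) = pgen_charact a.
Proof. exact: (projT2 (cid (pcharact_subproof n))). Qed.

Lemma pskel_incl_subproof n : exists u : functor (pskel n) (pskel n.+1),
  feq (fcomp (pskel_fst n.+1) u) (pskel_fst n) /\
  feq (fcomp (pskel_snd n.+1) u) (fcomp (skel_incl Q n) (pskel_snd n)).
Proof.
apply: pullback_lift (pskel_pullback n.+1) _ => m z.
rewrite !fcompE free_cat_in_incl; exact: (pullback_comm (pskel_pullback n)).
Qed.

Definition pskel_incl n : functor (pskel n) (pskel n.+1) :=
  projT1 (cid (pskel_incl_subproof n)).

Lemma pskel_inclP n :
  feq (fcomp (pskel_fst n.+1) (pskel_incl n)) (pskel_fst n) /\
  feq (fcomp (pskel_snd n.+1) (pskel_incl n)) (fcomp (skel_incl Q n) (pskel_snd n)).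
Proof. exact: (projT2 (cid (pskel_incl_subproof n))). Qed.

(** The definition of [pgen] enters in the fibre condition: a cell of the next stage over the
    generator [b] has its [C]-component in [pgen], with [b] as its image. *)
Lemma pskel_attachment n : is_attachment k (@pgen_src n) (@pgen_tgt n)
  (pskel_incl n) (@pgen_charact n).
Proof.
have [iu iv] := pskel_inclP n.
have [_ ss st _] := skel_attachment Q n.
apply: (pullback_attachment hf hC (@free_cat_omega_k k Q) (d := @pgen_map n.+1)
  (pskel_pullback n) (pskel_pullback n.+1) _ iu iv (@gen_parallel k Q n)
  (skel_attachment Q n)).
- by move=> m x; exact: free_cat_in_incl.
- by move=> a; case: (pgen_srcP a).
- move=> a; have [s1 s2] := pgen_srcP a; have [c1 c2] := pgen_charactP a.
  apply: (pullback_inj (pskel_pullback n.+1)); rewrite fmap_src.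
    by rewrite c1 -s1; exact: iu.
  by rewrite c2 ss -s2; exact: iv.
- by move=> a; case: (pgen_tgtP a).
- move=> a; have [s1 s2] := pgen_tgtP a; have [c1 c2] := pgen_charactP a.
  apply: (pullback_inj (pskel_pullback n.+1)); rewrite fmap_tgt.
    by rewrite c1 -s1; exact: iu.
  by rewrite c2 st -s2; exact: iv.
- by move=> a; case: (pgen_charactP a).
- move=> a a' e; apply: pgen_eq.
  by rewrite -(pgen_charactP a).1 -(pgen_charactP a').1 e.
move=> z b qz; have fz := @pullback_comm _ _ _ _ _ _ _ _ (pskel_pullback n.+1) _ z.
rewrite qz -gen_cellS in fz.
pose a : pgen n.+1 := exist _ _ (ex_intro _ b fz).
have ab : pgen_map a = b by exact: pgen_map_eq.
exists a => //; apply: (pullback_inj (pskel_pullback n.+1)).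
  by rewrite (pgen_charactP a).1.
by rewrite (pgen_charactP a).2 ab qz.
Qed.

Lemma pskel_pushout n : is_pushout k (spheres_incl k n (pgen n.+1)) (pattach n)
  (pskel_incl n) (pcharact n).
Proof.
apply: pushout_of_attachment; move: (pskel_attachment n).
have -> : @pgen_src n = fun a => pattach n n (spheres_cell k a (sphere_src n)).
  by apply/funext => a; rewrite pattach_src.
have -> : @pgen_tgt n = fun a => pattach n n (spheres_cell k a (sphere_tgt n)).
  by apply/funext => a; rewrite pattach_tgt.
have -> // : @pgen_charact n =
    fun a => pcharact n n.+1 (globes_cell k a (globe_top n.+1)).
by apply/funext => a; rewrite pcharactP.
Qed.

Lemma pskel_colimit : is_seq_colimit k pskel_incl pskel_fst.
Proof.
apply: (pullback_seq_colimit hf hC (free_cat_colimit Q) pskel_pullback) => n.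
  exact: (pskel_inclP n).1.
exact: (pskel_inclP n).2.
Qed.

(** The record accepts any colimit of the stages as its free category, so [C] with the projections
    [pskel_fst] is used; the isomorphism required at the end is then the identity. *)
Definition pullback_polygraph : polygraph k :=
  @Polygraph k pgen pstage pgen_src pgen_tgt pgen_parallel pattach pattach_src
    pattach_tgt pskel_incl pcharact pskel_pushout C pskel_fst pskel_colimit.

Lemma pullback_gen_cell n (a : pgen n) :
  gen_cell (P := pullback_polygraph) a = sval a.
Proof.
case: n a => [|n] a; first exact: idle_refl.
rewrite -[RHS](pgen_charactP a).1 -pcharactP //.
Qed.

End PullbackPolygraph.

(** * From [free_cat Q] to a category isomorphic to it *)

Definition id_iso (C : omega_cat) : iso C C :=
  @Iso C C (fid C) (fid C) (fun _ _ => erefl) (fun _ _ => erefl).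

(** The pulled-back polygraph needs a fibration onto [free_cat Q], while [D] is only isomorphic to
    it; composing [f] with the inverse isomorphism provides one. *)
Lemma iso_conduche C D D' (f : functor C D) (g : iso D' D) :
  discrete_conduche f -> discrete_conduche (fcomp (iso_inv g) f).
Proof.
have giK n x : g n (iso_inv g n x) = x by exact: (@iso_invK _ _ g).
have gK n x : iso_inv g n (g n x) = x by exact: (@iso_funK _ _ g).
move=> [h1 h2]; split.
  move=> n m h y x e; apply: (h1 n m h (g n y)).
  by rewrite -fmap_ident -e fcompE giK.
move=> n i h y1 y2 e x ex.
have e' := fmap_composable g e.
have [|p [[ep [-> p1 p2]] U]] := h2 n i h _ _ e' x.
  by rewrite -(fmap_comp e) -ex fcompE giK.
exists p; split.
  by exists ep; rewrite !fcompE p1 p2 !gK.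
move=> p' [ep' [c p1' p2']]; apply: U; exists ep'; split=> //.
  by rewrite -p1' fcompE giK.
by rewrite -p2' fcompE giK.
Qed.

Theorem theorem4p2p15 (k : option nat) (C D : omega_cat)
    (hC : is_omega_k k C) (hD : is_omega_k k D)
    (f : functor C D) (hf : discrete_conduche f)
    (Q : polygraph k) (q : freely_generated D Q) :
  exists (P : polygraph k) (p : freely_generated C P),
    forall n : nat,
      injective (fun a : gen P n => gen_incl p a) /\
      forall a : cell C n,
        (exists a' : gen P n, a = gen_incl p a') <->
        (exists b : gen Q n, f n a = gen_incl q b).
Proof.
have hf' := iso_conduche q hf.
exists (pullback_polygraph hf' hC), (id_iso C) => n.
have genE (a : pgen (fcomp (iso_inv q) f) n) :
    gen_incl (P := pullback_polygraph hf' hC) (id_iso C) a = sval a.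
  exact: pullback_gen_cell.
have fE (a : cell C n) (b : gen Q n) :
    f n a = gen_incl q b <-> fcomp (iso_inv q) f n a = gen_cell b.
  rewrite /gen_incl fcompE; split=> [->|<-]; first exact: (@iso_funK _ _ q).
  by apply: esym; exact: (@iso_invK _ _ q).
split=> [a a'|a]; first by rewrite !genE; exact: pgen_eq.
split=> [[a' ->]|[b /fE hb]].
  by rewrite genE; have [b /fE hb] := svalP a'; exists b.
by exists (exist _ a (ex_intro _ b hb)); rewrite genE.
Qed.
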